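(* Let $X$ be a locally compact Hausdorff space, let $\mathcal{H}$ be a finite-dimensional complex Hilbert space, let $\nu\in\mathrm{POVM}^1_{\mathcal{H}}(X)$, let $\mathcal{F}(X)$ be a sub-$\sigma$-algebra of $\mathcal{O}(X)$, and let $J\subset\mathbb{R}$ be an open interval containing a closed interval $[\alpha,\beta]$. If $\psi:X\to\mathcal{B}(\mathcal{H})$ is a quantum random variable for which $\psi^*=\psi$ and the eigenvalues of every $\psi(x)$ are contained within $[\alpha,\beta]$, then $$\mathbb{E}_\nu[\vartheta(\psi)\,|\,\mathcal{F}(X)]\ge\vartheta\left(\mathbb{E}_\nu[\psi\,|\,\mathcal{F}(X)]\right)$$ ($\nu$-almost everywhere) for every operator convex function $\vartheta:J\to\mathbb{R}$.
   Context: Let $d=\dim\mathcal{H}$; $\mathcal{O}(X)$ is the Borel $\sigma$-algebra of $X$; $\mathcal{B}(\mathcal{H})_+$ is the cone of positive operators, and $a\ge b$ for selfadjoint $a,b$ means $a-b\in\mathcal{B}(\mathcal{H})_+$. A state is a positive operator $\rho$ with $\operatorname{Tr}(\rho)=1$. $\mathrm{POVM}^1_{\mathcal{H}}(X)$ is the set of functions $\nu:\mathcal{O}(X)\to\mathcal{B}(\mathcal{H})$ with $\nu(E)\in\mathcal{B}(\mathcal{H})_+$ for all $E$, $\nu(X)=1$, countably additive on pairwise disjoint families ($\sigma$-weak convergence). A function $\psi:X\to\mathcal{B}(\mathcal{H})$ is $\mathcal{F}(X)$-measurable if $x\mapsto\operatorname{Tr}(\rho\psi(x))$ is $\mathcal{F}(X)$-measurable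 for every state $\rho$; a quantum random variable is such a function with $\mathcal{F}(X)=\mathcal{O}(X)$. With $\mu=\frac1d\operatorname{Tr}\circ\nu$, $\mathrm{d}\nu/\mathrm{d}\mu:X\to\mathcal{B}(\mathcal{H})_+$ is the Radon-Nikodým derivative: $\nu(E)=\int_E\frac{\mathrm{d}\nu}{\mathrm{d}\mu}\,\mathrm{d}\mu$ for all $E\in\mathcal{O}(X)$. A quantum random variable $\psi$ is $\nu$-integrable if for every state $\rho$ the function $\psi_\rho=\operatorname{Tr}\left(\rho\left(\frac{\mathrm{d}\nu}{\mathrm{d}\mu}\right)^{1/2}\psi\left(\frac{\mathrm{d}\nu}{\mathrm{d}\mu}\right)^{1/2}\right)$ is $\mu$-integrable; then $\mathbb{E}_\nu[\psi]=\int_X\psi\,\mathrm{d}\nu$ is the unique operator with $\operatorname{Tr}(\rho\,\mathbb{E}_\nu[\psi])=\int_X\psi_\rho\,\mathrm{d}\mu$ for every state $\rho$. The quantum conditional expectation $\mathbb{E}_\nu[\psi\,|\,\mathcal{F}(X)]$ is the function $\varphi:X\to\mathcal{B}(\mathcal{H})$ (versions differing on a $\nu$-null set are identified) that is $\mathcal{F}(X)$-measurable, $\nu$-integrable and satisfies $\mathbb{E}_\nu[\psi\chi_E]=\mathbb{E}_\nu[\varphi\chi_E]$ for every $E\in\mathcal{F}(X)$. (The paper defines this for $\psi$ with values in $\mathcal{B}(\mathcal{H})_+$ and $\mathbb{E}_\nu[\psi]\ne0$; here it is used, with the same characterising properties, for selfadjoint-valued $\psi$ and $\vartheta(\psi)$.)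 A function $\vartheta:J\to\mathbb{R}$ is operator convex if $\vartheta((1-t)a+tb)\le(1-t)\vartheta(a)+t\vartheta(b)$ for all $t\in[0,1]$ and all selfadjoint operators $a,b$ with spectra in $J$ (functional calculus); $\vartheta(\psi)$ is $x\mapsto\vartheta(\psi(x))$, and $\vartheta(\varphi)$ is likewise defined pointwise.
   Formalization: The expectation of the conditional expectation φ is taken with respect to ν restricted to F(X) and its F(X)-measurable derivative (with the Borel dν/dμ the claim is false), and conditional expectations are assumed unique ν-almost everywhere. *)

(* Defs.v *)
(* MathComp-Analysis: scalars are R[i] for a realType R, and B(H) with
   dim H = n is the matrix algebra 'M[R[i]]_n. *)
From HB Require Import structures.
From mathcomp Require Import all_boot all_order all_algebra.
From mathcomp Require Import complex.
From mathcomp Require Import all_classical all_reals all_analysis.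

Set Implicit Arguments.
Unset Strict Implicit.
Unset Printing Implicit Defensive.

Import Order.TTheory GRing.Theory Num.Theory.
Import numFieldNormedType.Exports.

Local Open Scope classical_set_scope.
Local Open Scope ring_scope.
Local Open Scope complex_scope.
Local Open Scope sesquilinear_scope.

Section operators.
Context {R : realType} {n : nat}.
Implicit Types a b rho : 'M[R[i]]_n.

(* The order of R[i] satisfies 0 <= z only for real z, so that this
   condition forces a to be selfadjoint. *)
Definition psdmx a := forall v : 'cV[R[i]]_n, 0 <= (v^t* *m a *m v) 0 0.

Definition lownerle a b := psdmx (b - a).

Definition is_state rho := psdmx rho /\ \tr rho = 1.

Definition spectrum_in (J : set R) a :=
  forall z, eigenvalue a z -> exists2 t, J t & z = t%:C.

Definition selfadjoint_in (J : set R) a := a \is hermsymmx /\ spectrum_in J a.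

(* Functional calculus through the spectral decomposition
   a = U^-1 *m diag_mx (spectral_diag a) *m U with U = spectralmx a unitary;
   meaningful for selfadjoint a only. *)
Definition mxfun (f : R -> R) a : 'M[R[i]]_n :=
  invmx (spectralmx a)
    *m diag_mx (map_mx (fun z => (f (complex.Re z))%:C) (spectral_diag a))
    *m spectralmx a.

Definition sqrtmx a := mxfun Num.sqrt a.

End operators.

(* The order k of the matrices is arbitrary: operator convexity is not tied
   to one fixed Hilbert space. Only the values of theta on J matter. *)
Definition operator_convex {R : realType} (J : set R) (theta : R -> R) :=
  forall (k : nat) (a b : 'M[R[i]]_k) (t : R), 0 <= t <= 1 ->
    selfadjoint_in J a -> selfadjoint_in J b ->
    lownerle (mxfun theta ((1 - t)%:C *: a + t%:C *: b))
             ((1 - t)%:C *: mxfun theta a + t%:C *: mxfun theta b).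

Section complex_integral.
Context {d} {T : measurableType d} {R : realType}.
Implicit Types (mu : {measure set T -> \bar R}) (D : set T) (f : T -> R[i]).

Definition cmeasurable_fun D f :=
  measurable_fun D (fun x => complex.Re (f x)) /\
  measurable_fun D (fun x => complex.Im (f x)).

Definition cintegrable mu D f :=
  mu.-integrable D (fun x => (complex.Re (f x))%:E) /\
  mu.-integrable D (fun x => (complex.Im (f x))%:E).

Definition cintegral mu D f : R[i] :=
  (\int[mu]_(x in D) complex.Re (f x)) +i* (\int[mu]_(x in D) complex.Im (f x)).

End complex_integral.

(* As for the measures of the library, a POVM is a total set function whose
   values on non-measurable sets are irrelevant; they are only required to be
   positive. The sigma-weak topology is that of the functionals
   a |-> \tr (rho *m a), rho trace class, hence arbitrary here. *)
Record povm d (T : measurableType d) (R : realType) (n : nat) := Povm {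
  povm_fun :> set T -> 'M[R[i]]_n ;
  povm_psd : forall E, psdmx (povm_fun E) ;
  povm_setT : povm_fun setT = 1%:M ;
  povm_sigma_additive : forall A : nat -> set T,
    (forall k, measurable (A k)) -> trivIset setT A ->
    forall rho : 'M[R[i]]_n,
      (\sum_(0 <= k < N) \tr (rho *m povm_fun (A k)) : R[i]^o) @[N --> \oo]
        --> (\tr (rho *m povm_fun (\bigcup_k A k)) : R[i]^o) }.

Section trace_measure.
Context d (T : measurableType d) (R : realType) (n : nat).
Variable nu : povm T R n.

Definition trace_measure (E : set T) : \bar R :=
  (n%:R^-1 * complex.Re (\tr (nu E)))%:E.

Let psd_diag (a : 'M[R[i]]_n) i : psdmx a -> 0 <= a i i.
Proof.
move=> /(_ (delta_mx i 0)).
by rewrite trmx_delta map_delta_mx -rowE -colE !mxE.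
Qed.

Let Re_cvg (u : nat -> R[i]) (l : R[i]) :
  (u N : R[i]^o) @[N --> \oo] --> (l : R[i]^o) ->
  complex.Re (u N) @[N --> \oo] --> complex.Re l.
Proof.
move=> /cvgrPdist_lt ul; apply/cvgrPdist_lt => e e0.
have /ul : 0 < e%:C :> R[i] by rewrite ltcR.
apply: filterS => N /= le.
rewrite -ltcR; apply: le_lt_trans le.
by rewrite -raddfB; exact: normc_ge_Re.
Qed.

Let trace_additive (A : nat -> set T) :
  (forall k, measurable (A k)) -> trivIset setT A ->
  \sum_(0 <= k < N) complex.Re (\tr (nu (A k))) @[N --> \oo]
    --> complex.Re (\tr (nu (\bigcup_k A k))).
Proof.
move=> mA tA; have := @povm_sigma_additive _ _ _ _ nu _ mA tA 1%:M.
rewrite mul1mx => /Re_cvg; apply: cvg_trans; apply: near_eq_cvg.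
near=> N; rewrite raddf_sum/=; apply: eq_bigr => k _; by rewrite mul1mx.
Unshelve. all: by end_near. Qed.

Let trace_measure0 : trace_measure set0 = 0%E.
Proof.
have := @trace_additive (fun=> set0) (fun=> measurable0) (@trivIset_set0 _ _ _).
rewrite bigcup0// => h; rewrite /trace_measure.
set c := complex.Re _ in h *.
suff -> : c = 0 by rewrite mulr0.
have h1 : \sum_(0 <= k < N) c + c @[N --> \oo] --> c.
  have := h; rewrite -(cvg_shiftS (fun N => \sum_(0 <= k < N) c)).
  apply: cvg_trans; apply: near_eq_cvg; apply: nearW => N.
  by rewrite /= big_nat_recr.
have h2 : \sum_(0 <= k < N) c + c @[N --> \oo] --> c + c.
  by apply: cvgD => //; exact: cvg_cst.
have /eqP : c + c = c by apply: cvg_unique h2 h1.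
by rewrite -subr_eq0 addrK => /eqP.
Qed.

Let trace_measure_ge0 E : (0 <= trace_measure E)%E.
Proof.
rewrite lee_fin mulr_ge0 ?invr_ge0// /mxtrace raddf_sum/= sumr_ge0// => i _.
by have /(psd_diag i) := povm_psd nu E; rewrite lecE /= => /andP[].
Qed.

Let trace_measure_sigma_additive : semi_sigma_additive trace_measure.
Proof.
move=> A mA tA _; rewrite /trace_measure.
rewrite (_ : (fun N => _) = EFin \o
    (fun N => n%:R^-1 * \sum_(0 <= k < N) complex.Re (\tr (nu (A k))))); last first.
  by apply/funext => N /=; rewrite mulr_sumr sumEFin.
apply: cvg_EFin; first exact: nearW.
by apply: cvgMl_tmp; exact: trace_additive.
Qed.

HB.instance Definition _ := isMeasure.Build _ T R trace_measure
  trace_measure0 trace_measure_ge0 trace_measure_sigma_additive.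

End trace_measure.

Section quantum_expectation.
Context {d} {T : measurableType d} {R : realType} {n : nat}.
Implicit Types (nu : povm T R n) (psi : T -> 'M[R[i]]_n).

Definition qmeasurable psi :=
  forall rho : 'M[R[i]]_n, is_state rho ->
    cmeasurable_fun setT (fun x => \tr (rho *m psi x)).

Definition is_povm_deriv nu (h : T -> 'M[R[i]]_n) :=
  [/\ forall x, psdmx (h x),
      qmeasurable h,
      forall i j, cintegrable (trace_measure nu) setT (fun x => h x i j) &
      forall E, measurable E ->
        nu E = \matrix_(i, j) cintegral (trace_measure nu) E (fun x => h x i j)].

Definition povm_deriv nu : T -> 'M[R[i]]_n := xget (fun=> 0) (is_povm_deriv nu).

Definition qdensity nu psi (rho : 'M[R[i]]_n) (x : T) : R[i] :=
  let s := sqrtmx (povm_deriv nu x) in \tr (rho *m (s *m psi x *m s)).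

Definition qintegrable nu psi :=
  qmeasurable psi /\
  forall rho, is_state rho ->
    cintegrable (trace_measure nu) setT (qdensity nu psi rho).

Definition qexpectation nu psi : 'M[R[i]]_n :=
  xget 0 [set a | forall rho, is_state rho ->
    \tr (rho *m a) = cintegral (trace_measure nu) setT (qdensity nu psi rho)].

Definition qrestrict psi (E : set T) : T -> 'M[R[i]]_n :=
  fun x => (\1_E x)%:C *: psi x.

Definition povm_ae nu (P : set T) :=
  exists N, [/\ measurable N, nu N = 0 & ~` P `<=` N].

End quantum_expectation.

Section conditional_expectation.
Context d (T : measurableType d) (R : realType) (n : nat).
Variables (nu : povm T R n) (F : set (set T)) (FT : F `<=` measurable).

Let restr_sigma_additive (A : nat -> set T) :
  (forall k, F.-sigma.-measurable (A k)) -> trivIset setT A ->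
  forall rho : 'M[R[i]]_n,
    (\sum_(0 <= k < N) \tr (rho *m nu (A k)) : R[i]^o) @[N --> \oo]
      --> (\tr (rho *m nu (\bigcup_k A k)) : R[i]^o).
Proof.
move=> mA; apply: povm_sigma_additive => k.
by apply: (smallest_sub _ FT (mA k)); exact: sigma_algebra_measurable.
Qed.

Definition povm_restr : povm (g_sigma_algebraType F) R n :=
  @Povm _ (g_sigma_algebraType F) R n nu
    (povm_psd nu) (povm_setT nu) restr_sigma_additive.

(* phi is a quantum random variable on (T, F), so its expectation is that of
   (T, F, nu|F), whose Radon-Nikodym derivative g is F-measurable. Unlike the
   classical integral, the quantum one is not preserved when the sigma-algebra
   is enlarged, and using the derivative of nu itself for phi would not give a
   positive conditional expectation: for nu {1} = diag(1/5, 4/5) and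
   nu {2} = diag(4/5, 1/5) on T = {1, 2}, with F trivial, psi 2 = 0 and
   psi 1 the projection 1/2 [1 1; 1 1], it would make phi the constant
   [1/10 1/4; 1/4 2/5], of negative determinant. *)
Definition qcondexp_spec (psi phi : T -> 'M[R[i]]_n) :=
  [/\ @qmeasurable _ (g_sigma_algebraType F) R n phi,
      qintegrable povm_restr phi &
      forall E, F E ->
        qexpectation nu (qrestrict psi E) =
        qexpectation povm_restr (qrestrict phi E)].

(* The conditional expectation is the function with these properties, hence
   the uniqueness clause. It is not automatic: where g is singular,
   the values of phi are not determined by qcondexp_spec. *)
Definition is_qcondexp (psi phi : T -> 'M[R[i]]_n) :=
  qcondexp_spec psi phi /\
  forall phi', qcondexp_spec psi phi' -> povm_ae nu [set x | phi' x = phi x].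

End conditional_expectation.

Notation borelType X := (g_sigma_algebraType (@open X)).

(* Main.v *)
Require Import Defs.
From HB Require Import structures.
From mathcomp Require Import all_boot all_order all_algebra.
From mathcomp Require Import complex.
From mathcomp Require Import all_classical all_reals all_analysis.
From mathcomp Require Import measurable_realfun ring lra.

Set Implicit Arguments.
Unset Strict Implicit.
Unset Printing Implicit Defensive.

Import Order.TTheory GRing.Theory Num.Theory.
Import numFieldNormedType.Exports.

Local Open Scope classical_set_scope.
Local Open Scope ring_scope.
Local Open Scope complex_scope.
Local Open Scope sesquilinear_scope.

(** Write [h] and [g] for the densities, with respect to the trace measure, of [nu] and of
    its restriction to [F]. By the definition of conditional expectations the triples
      - [(h, h^1/2 psi h^1/2, h^1/2 theta(psi) h^1/2)],
      - [(g, g^1/2 phi g^1/2, g^1/2 phi_theta g^1/2)]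
    have the same integrals over the sets of [F] ([condexp_mxintegral]). Diagonalizing
    [psi x] splits the first one into rank one pieces [(w^* w, lam w^* w, theta(lam) w^* w)]
    with [lam] in [[alpha, beta]]: it takes its values in the convex cone [jensen_cone]
    generated by them and by the triples [(0, 0, q)] with [q >= 0]. Therefore the second one almost everywhere takes its values in the
    bidual of this cone, the null set being common to all the functionals in the dual cone
    ([mx_ae_dual_nonneg]).

    What remains is a statement about three matrices. A triple [(g, m, p)] of the cone with
    [g] invertible satisfies [theta(g^-1/2 m g^-1/2) <= g^-1/2 p g^-1/2], because it
    comes from the compression of a diagonal matrix by an isometry ([jensen_compression]);
    this uses operator convexity for matrices of the size of the diagonal one. To go from
    the bidual back to the cone, the interval is enlarged inside [J], which makes
    [(g, m, q)] an order unit for large [q] ([jensen_cone_order_unit]): then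
    [((1 + eps) g, (1 + eps) m, p + eps q)] is in the cone ([bidual_order_unit]),
    [g^-1/2 m g^-1/2] is unchanged, and [eps] tends to 0 ([bidual_jensen]).

    The density [g] is almost everywhere invertible because the conditional expectation is
    unique: the projection onto the kernel of [g] could otherwise be added to [phi]
    ([condexp_deriv_unit]). The analytic prerequisites are the existence of the densities
    ([povm_derivP]) and the measurability of [h^1/2] and [theta(psi)]
    ([mxfun_measurable]). *)

(** * Quadratic forms and positive matrices *)

Definition qform {C : numClosedFieldType} {n} (a : 'M[C]_n) (v : 'cV[C]_n) : C :=
  (v^t* *m a *m v) 0 0.

Section quadratic_forms.
Context {C : numClosedFieldType}.

Lemma adjmxM m n p (a : 'M[C]_(m, n)) (b : 'M[C]_(n, p)) :
  (a *m b)^t* = b^t* *m a^t*.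
Proof. by rewrite trmx_mul map_mxM. Qed.

Lemma adjmxK m n (a : 'M[C]_(m, n)) : (a^t*)^t* = a.
Proof. exact: trmxCK. Qed.

Lemma adjmxD m n (a b : 'M[C]_(m, n)) : (a + b)^t* = a^t* + b^t*.
Proof. by rewrite linearD /= map_mxD. Qed.

Lemma adjmxB m n (a b : 'M[C]_(m, n)) : (a - b)^t* = a^t* - b^t*.
Proof. by rewrite linearB /= map_mxB. Qed.

Lemma adjmxZ m n c (a : 'M[C]_(m, n)) : (c *: a)^t* = Num.conj c *: a^t*.
Proof. by apply/matrixP => i j; rewrite !mxE rmorphM. Qed.

Lemma adjmx1 n : (1%:M : 'M[C]_n)^t* = 1%:M.
Proof. by rewrite trmx1 map_mx1. Qed.

Lemma hermmxP n (a : 'M[C]_n) : reflect (a^t* = a) (a \is hermsymmx).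
Proof.
apply: (iffP (is_hermitianmxP _ _ _)); rewrite expr0 scale1r.
  by move=> {2}->.
by move=> {1}<-.
Qed.

Lemma qformD n (a b : 'M[C]_n) v : qform (a + b) v = qform a v + qform b v.
Proof. by rewrite /qform mulmxDr mulmxDl mxE. Qed.

Lemma qformB n (a b : 'M[C]_n) v : qform (a - b) v = qform a v - qform b v.
Proof. by rewrite /qform mulmxBr mulmxBl !mxE. Qed.

Lemma qformZ n c (a : 'M[C]_n) v : qform (c *: a) v = c * qform a v.
Proof. by rewrite /qform -scalemxAr -scalemxAl mxE. Qed.

Lemma qform_congr n k (a : 'M[C]_n) (w : 'M[C]_(n, k)) v :
  qform (w^t* *m a *m w) v = qform a (w *m v).
Proof. by rewrite /qform adjmxM !mulmxA. Qed.

Lemma qform_adj n (a : 'M[C]_n) v : qform (a^t*) v = Num.conj (qform a v).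
Proof.
rewrite /qform -[X in (_ *m _ *m X) 0 0]adjmxK -!adjmxM.
by rewrite mxE [in LHS]mxE mulmxA.
Qed.

Lemma qform_tr n (a : 'M[C]_n) v : qform a v = \tr (v *m v^t* *m a).
Proof. by rewrite -mulmxA mxtrace_mulC /qform /mxtrace big_ord1. Qed.

Lemma qform_basis n (a : 'M[C]_n) i : qform a (delta_mx i 0) = a i i.
Proof. by rewrite /qform trmx_delta map_delta_mx -rowE -colE !mxE. Qed.

Lemma qform_delta n (a : 'M[C]_n) i j c :
  qform a (delta_mx i 0 + c *: delta_mx j 0) =
  a i i + c * a i j + Num.conj c * a j i + c * Num.conj c * a j j.
Proof.
rewrite /qform adjmxD adjmxZ !trmx_delta !map_delta_mx mulmxDl !mulmxDr.
rewrite -!scalemxAl -!scalemxAr -!rowE -!colE !mxE.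
by ring.
Qed.

(** The coefficient 0 puts all vectors in the form [e_i + c e_j] of [qform_delta], which
    covers the diagonal entries [i = j] as well. *)
Definition polar {n} (q : 'cV[C]_n -> C) (i j : 'I_n) : C :=
  2^-1 * (q (delta_mx i 0 + 1 *: delta_mx j 0)
          - 'i%R * q (delta_mx i 0 + 'i%R *: delta_mx j 0))
  - 2^-1 * (1 - 'i%R) * (q (delta_mx i 0 + 0 *: delta_mx j 0)
                         + q (delta_mx j 0 + 0 *: delta_mx i 0)).

Lemma polarization n (a : 'M[C]_n) i j : a i j = polar (qform a) i j.
Proof.
rewrite /polar !qform_delta conjCi rmorph1 rmorph0.
have := sqrCi C; set z := 'i%R => z2.
rewrite [X in _ - z * X]addrC; by field: z2; rewrite ?pnatr_eq0.
Qed.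

End quadratic_forms.

Section positive_matrices.
Context {R : realType}.
Local Notation C := R[i].

Lemma cReM (x y : C) : complex.Re (x * y) =
  complex.Re x * complex.Re y - complex.Im x * complex.Im y.
Proof. by case: x => a b; case: y. Qed.

Lemma cImM (x y : C) : complex.Im (x * y) =
  complex.Re x * complex.Im y + complex.Im x * complex.Re y.
Proof. by case: x => a b; case: y. Qed.

(** Nonnegative elements of [R[i]] are real; this expresses nonnegativity, reality
    included, through real parts, which are what real-linear functionals see. *)
Lemma ge0_Re_mulP (q : C) :
  0 <= q <-> forall kap : C, 0 <= complex.Re kap -> 0 <= complex.Re (kap * q).
Proof.
split=> [|key].
  case: q => x y; rewrite lecE => /andP[/= /eqP -> x0] kap kap0.
  by rewrite cReM /= mulr0 subr0 mulr_ge0.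
move: key; case: q => x y key.
have := key 1; have := key 'i%C; have := key (- 'i%C).
rewrite !cReM /= !mul0r !mul1r oppr0 !mul0r !sub0r mulN1r opprK.
move=> /(_ (lexx _)) y0 /(_ (lexx _)) y1 /(_ ler01) x0.
rewrite lecE /=; apply/andP; split; last by lra.
by apply/eqP; lra.
Qed.

Lemma psdmx0 n : psdmx (0 : 'M[C]_n).
Proof. by move=> v; rewrite mulmx0 mul0mx mxE. Qed.

Lemma psdmxD n (a b : 'M[C]_n) : psdmx a -> psdmx b -> psdmx (a + b).
Proof. by move=> pa pb v; rewrite [X in 0 <= X]qformD addr_ge0 ?pa ?pb. Qed.

Lemma psdmxZ n (c : C) (a : 'M[C]_n) : 0 <= c -> psdmx a -> psdmx (c *: a).
Proof. by move=> c0 pa v; rewrite [X in 0 <= X]qformZ mulr_ge0 ?pa. Qed.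

Lemma psdmx_congr n k (a : 'M[C]_n) (w : 'M[C]_(n, k)) :
  psdmx a -> psdmx (w^t* *m a *m w).
Proof. by move=> pa v; rewrite [X in 0 <= X]qform_congr pa. Qed.

Lemma qform1_ge0 n (v : 'cV[C]_n) : 0 <= qform 1%:M v.
Proof.
rewrite /qform mulmx1 mxE sumr_ge0 // => i _.
by rewrite !mxE mulrC mul_conjC_ge0.
Qed.

Lemma psdmx_gram n k (w : 'M[C]_(k, n)) : psdmx (w^t* *m w).
Proof.
by rewrite -[X in X *m _]mulmx1; apply: psdmx_congr => v; exact: qform1_ge0.
Qed.

Lemma qform_inj n (a b : 'M[C]_n) : (forall v, qform a v = qform b v) -> a = b.
Proof.
by move=> /funext ab; apply/matrixP => i j; rewrite !polarization ab.
Qed.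

Lemma psdmx_herm n (a : 'M[C]_n) : psdmx a -> a \is hermsymmx.
Proof.
move=> pa; apply/hermmxP/qform_inj => v; rewrite qform_adj.
by apply/CrealP; rewrite ger0_real // pa.
Qed.

Lemma hermmxD n (a b : 'M[C]_n) :
  a \is hermsymmx -> b \is hermsymmx -> a + b \is hermsymmx.
Proof. by move=> /hermmxP ha /hermmxP hb; apply/hermmxP; rewrite adjmxD ha hb. Qed.

Lemma hermmxB n (a b : 'M[C]_n) :
  a \is hermsymmx -> b \is hermsymmx -> a - b \is hermsymmx.
Proof. by move=> /hermmxP ha /hermmxP hb; apply/hermmxP; rewrite adjmxB ha hb. Qed.

Lemma hermmxZ n (c : R) (a : 'M[C]_n) :
  a \is hermsymmx -> c%:C *: a \is hermsymmx.
Proof.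
move=> /hermmxP ha; apply/hermmxP; rewrite adjmxZ ha; congr (_ *: _).
exact: conjc_real.
Qed.

Lemma hermmx_congr n k (a : 'M[C]_n) (w : 'M[C]_(n, k)) :
  a \is hermsymmx -> w^t* *m a *m w \is hermsymmx.
Proof.
by move=> /hermmxP ha; apply/hermmxP; rewrite !adjmxM adjmxK ha mulmxA.
Qed.

Lemma hermmx1 n : (1%:M : 'M[C]_n) \is hermsymmx.
Proof. by apply/hermmxP; rewrite adjmx1. Qed.

Definition rdiag {n} (lam : 'I_n -> R) : 'M[C]_n :=
  diag_mx (\row_i (lam i)%:C).

Lemma rdiag_adj n (lam : 'I_n -> R) : (rdiag lam)^t* = rdiag lam.
Proof.
rewrite /rdiag tr_diag_mx map_diag_mx; congr diag_mx.
by apply/rowP => i; rewrite !mxE; exact: conjc_real.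
Qed.

Lemma rdiag_herm n (lam : 'I_n -> R) : rdiag lam \is hermsymmx.
Proof. by apply/hermmxP; rewrite rdiag_adj. Qed.

Lemma mul_rdiagE m n (a : 'M[C]_(m, n)) (lam : 'I_n -> R) i j :
  (a *m rdiag lam) i j = a i j * (lam j)%:C.
Proof. by rewrite mul_mx_diag !mxE. Qed.

Lemma rdiag_mulE m n (a : 'M[C]_(m, n)) (lam : 'I_m -> R) i j :
  (rdiag lam *m a) i j = (lam i)%:C * a i j.
Proof. by rewrite mul_diag_mx !mxE. Qed.

Lemma psd_rdiag n (lam : 'I_n -> R) : (forall i, 0 <= lam i) -> psdmx (rdiag lam).
Proof.
move=> lam0 v; rewrite mxE sumr_ge0 // => i _.
by rewrite mul_rdiagE !mxE mulrAC mulrC mulr_ge0 ?lecR // mulrC mul_conjC_ge0.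
Qed.

End positive_matrices.

(** * Functional calculus *)

Section functional_calculus.
Context {R : realType}.

Local Notation C := R[i].

Definition specval {n} (a : 'M[C]_n) (i : 'I_n) : R :=
  complex.Re (spectral_diag a 0 i).

Lemma spectralmxK n (a : 'M[C]_n) : spectralmx a *m (spectralmx a)^t* = 1%:M.
Proof. exact/unitarymxP/spectral_unitarymx. Qed.

Lemma spectralmxVK n (a : 'M[C]_n) : (spectralmx a)^t* *m spectralmx a = 1%:M.
Proof. exact/mulmx1C/spectralmxK. Qed.

Lemma mxfunE n (f : R -> R) (a : 'M[C]_n) :
  mxfun f a = (spectralmx a)^t* *m rdiag (f \o specval a) *m spectralmx a.
Proof.
rewrite /mxfun (invmx_unitary (spectral_unitarymx a)) /rdiag.
rewrite [X in diag_mx X](_ : _ = \row_i ((f \o specval a) i)%:C) //.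
by apply/rowP => i; rewrite !mxE.
Qed.

Lemma spectral_decomposition n (a : 'M[C]_n) : a \is hermsymmx ->
  a = (spectralmx a)^t* *m rdiag (specval a) *m spectralmx a.
Proof.
move=> ha; have /orthomx_spectralP {1}-> := hermitian_normalmx ha.
rewrite (invmx_unitary (spectral_unitarymx a)) /rdiag.
rewrite [X in diag_mx X](_ : _ = \row_i (specval a i)%:C) //.
apply/rowP => i; rewrite mxE.
have /mxOverP/(_ 0 i) := hermitian_spectral_diag_real ha.
rewrite /specval; case: (spectral_diag a 0 i) => x y.
by rewrite complex_real => /= /eqP ->.
Qed.

Lemma mxfun_coefE n (f : R -> R) (a : 'M[C]_n) i j :
  mxfun f a i j = \sum_k
    (Num.conj (spectralmx a k i) * spectralmx a k j) * (f (specval a k))%:C.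
Proof.
rewrite mxfunE mxE; apply: eq_bigr => k _.
by rewrite mul_rdiagE !mxE mulrAC.
Qed.

Lemma mxfun_herm n (f : R -> R) (a : 'M[C]_n) : mxfun f a \is hermsymmx.
Proof. by rewrite mxfunE; apply/hermmx_congr/rdiag_herm. Qed.

Lemma mxfun_id n (a : 'M[C]_n) : a \is hermsymmx -> mxfun id a = a.
Proof. by move=> ha; rewrite mxfunE -spectral_decomposition. Qed.

Lemma rdiagM n (f g : 'I_n -> R) : rdiag f *m rdiag g = rdiag (fun i => f i * g i).
Proof.
apply/matrixP => i j; rewrite mul_rdiagE !mxE.
by rewrite mulrnAl rmorphM; case: eqVneq => // ->.
Qed.

Lemma rdiagD n (f g : 'I_n -> R) : rdiag f + rdiag g = rdiag (fun i => f i + g i).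
Proof. by apply/matrixP => i j; rewrite !mxE -mulrnDl rmorphD. Qed.

Lemma rdiagZ n c (g : 'I_n -> R) : c%:C *: rdiag g = rdiag (fun i => c * g i).
Proof. by apply/matrixP => i j; rewrite !mxE mulrnAr rmorphM. Qed.

Lemma rdiag1 n : rdiag (fun=> 1) = 1%:M :> 'M[C]_n.
Proof. by apply/matrixP => i j; rewrite !mxE. Qed.

Lemma mxfunM n (f g : R -> R) (a : 'M[C]_n) :
  mxfun (fun x => f x * g x) a = mxfun f a *m mxfun g a.
Proof.
rewrite !mxfunE !mulmxA -(mulmxA _ (spectralmx a) ((spectralmx a)^t*)).
by rewrite spectralmxK mulmx1 -(mulmxA _ (rdiag _) (rdiag _)) rdiagM.
Qed.

Lemma mxfunD n (f g : R -> R) (a : 'M[C]_n) :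
  mxfun (fun x => f x + g x) a = mxfun f a + mxfun g a.
Proof. by rewrite !mxfunE -mulmxDl -mulmxDr rdiagD. Qed.

Lemma mxfunZ n c (g : R -> R) (a : 'M[C]_n) :
  mxfun (fun x => c * g x) a = c%:C *: mxfun g a.
Proof. by rewrite !mxfunE scalemxAl scalemxAr rdiagZ. Qed.

Lemma mxfun_cst n c (a : 'M[C]_n) : mxfun (fun=> c) a = c%:C *: 1%:M.
Proof.
rewrite -[c]mulr1 (mxfunZ c (fun=> 1)) mxfunE (_ : _ \o _ = fun=> 1)//.
by rewrite rdiag1 mulmx1 spectralmxVK mulr1.
Qed.

Lemma eq_mxfun n (f g : R -> R) (a : 'M[C]_n) :
  (forall i, f (specval a i) = g (specval a i)) -> mxfun f a = mxfun g a.
Proof.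
by move=> fg; rewrite !mxfunE (_ : f \o _ = g \o specval a) //; apply/funext.
Qed.

Lemma psd_mxfun n (f : R -> R) (a : 'M[C]_n) :
  (forall i, 0 <= f (specval a i)) -> psdmx (mxfun f a).
Proof. by move=> f0; rewrite mxfunE; apply/psdmx_congr/psd_rdiag. Qed.

Lemma specval_qform n (a : 'M[C]_n) i : a \is hermsymmx ->
  (specval a i)%:C = qform a (col i ((spectralmx a)^t*)).
Proof.
move=> ha; rewrite {2}(spectral_decomposition ha) qform_congr colE mulmxA spectralmxK.
by rewrite mul1mx qform_basis !mxE eqxx.
Qed.

Lemma specval_eigen n (a : 'M[C]_n) i : a \is hermsymmx ->
  eigenvalue a (specval a i)%:C.
Proof.
move=> ha; apply/eigenvalueP; exists (row i (spectralmx a)).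
  rewrite -row_mul {2}(spectral_decomposition ha) !mulmxA spectralmxK mul1mx.
  by apply/rowP => j; rewrite [LHS]mxE rdiag_mulE !mxE.
apply/eqP => r0; have /matrixP/(_ i i) := spectralmxK a.
rewrite !mxE eqxx (eq_bigr (fun=> 0)) ?big1_eq => [|j _].
  by move/eqP; rewrite eq_sym oner_eq0.
by have /rowP/(_ j) := r0; rewrite !mxE => ->; rewrite mul0r.
Qed.

Lemma spectrum_specval n (J : set R) (a : 'M[C]_n) i : a \is hermsymmx ->
  spectrum_in J a -> J (specval a i).
Proof. by move=> ha /(_ _ (specval_eigen i ha)) [t Jt [->]]. Qed.

(** Where the eigenvalue of [a] differs from the entry of [lam], the corresponding
    coefficient of [z] in an eigenbasis of [a] vanishes. Hence the functional calculus
    may be computed in any eigenbasis. *)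
Lemma mxfun_eigenbasis n k (f : R -> R) (a : 'M[C]_n) (z : 'M[C]_(n, k)) lam :
  a \is hermsymmx -> a *m z = z *m rdiag lam ->
  mxfun f a *m z = z *m rdiag (f \o lam).
Proof.
move=> ha az; set u := spectralmx a.
suff e : rdiag (f \o specval a) *m (u *m z) = (u *m z) *m rdiag (f \o lam).
  by rewrite mxfunE -/u -!mulmxA e !mulmxA spectralmxVK mul1mx.
have {}az : rdiag (specval a) *m (u *m z) = (u *m z) *m rdiag lam.
  rewrite -!mulmxA -az {2}(spectral_decomposition ha) -/u !mulmxA.
  by rewrite spectralmxK mul1mx.
apply/matrixP => i j; rewrite rdiag_mulE mul_rdiagE /=.
have /matrixP/(_ i j) := az; rewrite rdiag_mulE mul_rdiagE mulrC.
have [->|nz] := eqVneq ((u *m z) i j) 0; first by rewrite !mul0r mulr0.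
by move/(mulfI nz) => [->]; rewrite mulrC.
Qed.

(** With [z] an isometry, this relates the functional calculus of a matrix to that of
    its restriction to an invariant subspace, possibly of another size. *)
Lemma mxfun_intertwine n k (f : R -> R) (a : 'M[C]_n) (b : 'M[C]_k) z :
  a \is hermsymmx -> b \is hermsymmx -> a *m z = z *m b ->
  mxfun f a *m z = z *m mxfun f b.
Proof.
move=> ha hb az; pose u := spectralmx b.
have e : a *m (z *m u^t*) = z *m u^t* *m rdiag (specval b).
  rewrite mulmxA az {1}(spectral_decomposition hb) -/u -!mulmxA.
  by rewrite spectralmxK mulmx1.
rewrite [mxfun f b]mxfunE -/u !mulmxA -(mxfun_eigenbasis f ha e).
by rewrite -!mulmxA spectralmxVK mulmx1.
Qed.

Lemma mxfun_rdiag n (f : R -> R) (lam : 'I_n -> R) :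
  mxfun f (rdiag lam) = rdiag (f \o lam).
Proof.
rewrite -[LHS]mulmx1 -[RHS]mul1mx; apply: mxfun_eigenbasis; first exact: rdiag_herm.
by rewrite mulmx1 mul1mx.
Qed.

Lemma psd_spectrum n (lo hi : R) (a : 'M[C]_n) :
  psdmx (a - lo%:C *: 1%:M) -> psdmx (hi%:C *: 1%:M - a) ->
  selfadjoint_in `[lo, hi] a.
Proof.
move=> plo phi.
have ha : a \is hermsymmx.
  by have := hermmxD (psdmx_herm plo) (hermmxZ lo (hermmx1 n)); rewrite subrK.
split => // z /eigenvalueP [v va v0].
have e : a *m v^t* = z^* *: v^t*.
  by rewrite -adjmxZ -va adjmxM; move/hermmxP: ha => ->.
have vv : 0 < qform 1%:M (v^t*).
  rewrite lt_def qform1_ge0 andbT; apply: contra v0 => /eqP.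
  rewrite /qform adjmxK mulmx1 mxE => /eqP.
  rewrite psumr_eq0 => [|i _]; last by rewrite !mxE mul_conjC_ge0.
  move=> /allP v0; apply/eqP/rowP => i.
  have := v0 i (mem_index_enum _); rewrite !mxE mul_conjC_eq0 => /eqP; exact.
have qa : qform a (v^t*) = z^* * qform 1%:M (v^t*).
  by rewrite /qform -mulmxA e -!scalemxAr !mxE mulmx1.
have := plo (v^t*); have := phi (v^t*).
rewrite [X in 0 <= X -> _]qformB [X in _ -> 0 <= X -> _]qformB !qformZ qa.
rewrite -!mulrBl !pmulr_lge0//.
rewrite !subr_ge0; case: z {va e qa} => x y; rewrite !lecE /= => /andP[/eqP].
move=> /esym/eqP; rewrite oppr_eq0 => /eqP -> xhi /andP[_ lox].
by exists x => //=; rewrite in_itv /= lox xhi.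
Qed.

Lemma spectrum_psd n (lo hi : R) (a : 'M[C]_n) : selfadjoint_in `[lo, hi] a ->
  psdmx (a - lo%:C *: 1%:M) /\ psdmx (hi%:C *: 1%:M - a).
Proof.
move=> [ha sa].
have h i : lo <= specval a i <= hi by exact: (spectrum_specval i ha sa).
split.
  have -> : a - lo%:C *: 1%:M = mxfun (fun x => x + - lo) a.
    by rewrite (mxfunD id (fun=> - lo)) (mxfun_id ha) mxfun_cst rmorphN scaleNr.
  by apply: psd_mxfun => i; rewrite subr_ge0; have /andP[] := h i.
have -> : hi%:C *: 1%:M - a = mxfun (fun x => hi + -1 * x) a.
  rewrite (mxfunD (fun=> hi) (fun x => -1 * x)) (mxfunZ (-1) id) (mxfun_id ha).
  by rewrite mxfun_cst rmorphN1 scaleN1r.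
by apply: psd_mxfun => i; rewrite mulN1r subr_ge0; have /andP[] := h i.
Qed.

Lemma specval_ge0 n (a : 'M[C]_n) i : psdmx a -> 0 <= specval a i.
Proof.
move=> pa; rewrite -lecR (specval_qform i (psdmx_herm pa)); exact: pa.
Qed.

Lemma sqrtmx_herm n (a : 'M[C]_n) : sqrtmx a \is hermsymmx.
Proof. exact: mxfun_herm. Qed.

Lemma sqrtmxK n (a : 'M[C]_n) : psdmx a -> sqrtmx a *m sqrtmx a = a.
Proof.
move=> pa; rewrite -[RHS](mxfun_id (psdmx_herm pa)) -mxfunM.
by apply: eq_mxfun => i; rewrite -expr2 sqr_sqrtr// specval_ge0.
Qed.

Lemma mxfun_comp n (f g : R -> R) (a : 'M[C]_n) :
  mxfun f (mxfun g a) = mxfun (f \o g) a.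
Proof.
set u := spectralmx a.
have e : mxfun g a *m u^t* = u^t* *m rdiag (g \o specval a).
  by rewrite mxfunE -/u -(mulmxA _ u (u^t*)) (spectralmxK a) mulmx1.
have := mxfun_eigenbasis f (mxfun_herm g a) e.
rewrite [mxfun (f \o g) a]mxfunE -/u => <-.
by rewrite -(mulmxA _ (u^t*) u) (spectralmxVK a) mulmx1.
Qed.

Lemma tr_mxfun n (f : R -> R) (a : 'M[C]_n) :
  \tr (mxfun f a) = (\sum_i f (specval a i))%:C.
Proof.
rewrite mxfunE mxtrace_mulC mulmxA spectralmxK mul1mx mxtrace_diag rmorph_sum.
by apply: eq_bigr => i _; rewrite mxE.
Qed.

Lemma psd_tr0 n (a : 'M[C]_n) : psdmx a -> complex.Re (\tr a) = 0 -> a = 0.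
Proof.
move=> pa; rewrite -{1}(mxfun_id (psdmx_herm pa)) tr_mxfun /= => /eqP.
rewrite psumr_eq0 => [/allP s0|i _]; last exact: specval_ge0.
rewrite -(mxfun_id (psdmx_herm pa)).
transitivity (mxfun (fun=> 0) a); last by rewrite mxfun_cst scale0r.
by apply: eq_mxfun => i; apply/eqP/s0/mem_index_enum.
Qed.

End functional_calculus.

(** * Jensen's inequality for compressions, and separation in convex cones *)

Section compression.
Context {R : realType}.
Local Notation C := R[i].

Lemma rdiag_selfadjoint_in n (J : set R) (lam : 'I_n -> R) :
  (forall i, J (lam i)) -> selfadjoint_in J (rdiag lam).
Proof.
move=> Jlam; split; first exact: rdiag_herm.
move=> z /eigenvalueP [v vz /eqP v0].
have [i vi] : exists i, v 0 i != 0.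
  apply: contrapT => nv; apply: v0; apply/rowP => i; rewrite mxE.
  by apply/eqP/negP => vi; apply: nv; exists i; apply/negP.
exists (lam i) => //; apply/esym/(mulfI vi).
by have /rowP/(_ i) := vz; rewrite mul_rdiagE mxE [RHS]mulrC.
Qed.

Lemma congr_selfadjoint_in n (J : set R) (a s : 'M[C]_n) :
  s^t* = s -> s *m s = 1%:M -> selfadjoint_in J a -> selfadjoint_in J (s *m a *m s).
Proof.
move=> sa ss [ha Ja]; split; first by rewrite -{1}sa; exact: hermmx_congr.
move=> z /eigenvalueP [v vz v0]; apply: Ja; apply/eigenvalueP; exists (v *m s).
  rewrite scalemxAl -vz -!mulmxA; congr (_ *m (_ *m _)).
  by rewrite ss mulmx1.
by apply: contra v0 => /eqP vs; rewrite -[v]mulmx1 -ss mulmxA vs mul0mx.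
Qed.

(** With [p = v v^*], the reflection [s = 2 p - 1] is unitary, and the mean of [d] and
    [s d s] commutes with [p] while having the same compression by [v] as [d]. Operator
    convexity at this midpoint, compressed by [v], is the claim. *)
Lemma jensen_compression (J : set R) (theta : R -> R) n k (v : 'M[C]_(k, n))
    (lam : 'I_k -> R) :
  operator_convex J theta -> v^t* *m v = 1%:M -> (forall i, J (lam i)) ->
  lownerle (mxfun theta (v^t* *m rdiag lam *m v))
           (v^t* *m rdiag (theta \o lam) *m v).
Proof.
move=> theta_convex vv Jlam.
pose s := v *m v^t* + v *m v^t* - 1%:M.
have sa : s^t* = s by rewrite adjmxB adjmxD adjmxM adjmxK adjmx1.
have sv : s *m v = v.
  by rewrite mulmxBl mulmxDl -!mulmxA vv mulmx1 mul1mx addrK.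
have vs : v^t* *m s = v^t* by rewrite -{1}sa -adjmxM sv.
have ss : s *m s = 1%:M.
  rewrite {1}/s mulmxBl mulmxDl -!mulmxA vs mul1mx.
  by rewrite /s opprB addrC subrK.
pose d := rdiag lam; pose d' := s *m d *m s.
have hd : selfadjoint_in J d by exact: rdiag_selfadjoint_in.
have hd' : selfadjoint_in J d' by exact: congr_selfadjoint_in.
have fd' : mxfun theta d' = s *m rdiag (theta \o lam) *m s.
  have e : d *m s = s *m d' by rewrite /d' !mulmxA ss mul1mx.
  have := mxfun_intertwine theta hd.1 hd'.1 e.
  by rewrite mxfun_rdiag -mulmxA => ->; rewrite mulmxA ss mul1mx.
have half : 0 <= (2^-1 : R) <= 1 by rewrite invr_ge0 ler0n invf_le1 ?ler1n.
have := theta_convex k d d' _ half hd hd'.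
set b := _ *: d + _ => /(psdmx_congr v).
have bv : b *m v = v *m (v^t* *m rdiag lam *m v).
  rewrite /b mulmxDl -!scalemxAl /d' -!mulmxA sv -/d /s.
  rewrite mulmxBl mul1mx mulmxDl -!mulmxA.
  set X := v *m _; set Y := d *m v.
  rewrite (_ : 1 - 2^-1 = 2^-1 :> R); last by lra.
  rewrite scalerBr addrC subrK scalerDr -scalerDl -rmorphD.
  by rewrite (_ : 2^-1 + 2^-1 = 1 :> R) ?scale1r//; lra.
have hb : b \is hermsymmx by apply: hermmxD; apply: hermmxZ; [exact: hd.1|exact: hd'.1].
have hc : v^t* *m rdiag lam *m v \is hermsymmx by apply/hermmx_congr/rdiag_herm.
have fb := mxfun_intertwine theta hb hc bv.
rewrite mulmxBr mulmxBl -[_ *m mxfun theta b *m _]mulmxA fb mulmxA vv mul1mx.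
rewrite mxfun_rdiag fd' mulmxDr mulmxDl -!scalemxAr -!scalemxAl !mulmxA vs.
rewrite -(mulmxA _ s v) sv -scalerDl -rmorphD subrK scale1r.
exact.
Qed.

End compression.

Section cone_separation.
Context {R : realType} {V : lmodType R[i]}.

Definition convex_cone (A : set V) :=
  (forall u v, A u -> A v -> A (u + v)) /\
  (forall (c : R) u, 0 < c -> A u -> A (c%:C *: u)).

Variables (K : set V) (e y : V).
Hypotheses (coneK : convex_cone K) (K0 : K 0).
Hypothesis unit_e : forall v, exists2 t : R, 0 < t & K (t%:C *: e + v).

Let scaleVK (c : R) (v : V) : 0 < c -> (c^-1)%:C *: (c%:C *: v) = v.
Proof. by move=> c0; rewrite scalerA -rmorphM mulVf ?scale1r// gt_eqF. Qed.

Let Ke : K e.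
Proof.
have [t t0] := unit_e 0; rewrite addr0 => /(coneK.2 t^-1).
by rewrite scaleVK ?invr_gt0//; exact.
Qed.

(** Zorn's lemma for the cones that contain [K] and [- y] and avoid [- e]. If a maximal
    one contained neither [v] nor [- v], adjoining either of them would produce [- e], and
    the combination of both decompositions eliminating [v] would put [- e] in the cone. *)
Lemma maximal_cone : ~ K y -> exists A : set V,
  [/\ convex_cone A, K `<=` A, A (- y), ~ A (- e) & forall v, A v \/ A (- v)].
Proof.
move=> nKy; have [KD KZ] := coneK.
pose K1 := [set v | exists k (s : R), [/\ K k, 0 <= s & v = k - s%:C *: y]].
have K1K : K `<=` K1 by move=> k Kk; exists k, 0; rewrite scale0r subr0.
have cK1 : convex_cone K1.
  split => [_ _ [k [s [Kk s0 ->]]] [l [t [Kl t0 ->]]]|c _ c0 [k [s [Kk s0 ->]]]].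
    exists (k + l), (s + t); rewrite addr_ge0//; split => //; first exact: KD.
    by rewrite rmorphD scalerDl opprD addrACA.
  exists (c%:C *: k), (c * s); rewrite (mulr_ge0 (ltW c0) s0); split => //; first exact: KZ.
  by rewrite scalerBr scalerA -rmorphM.
have K1e : ~ K1 (- e).
  move=> [k [s [Kk]]]; rewrite le_eqVlt => /predU1P[<-|s0].
    rewrite scale0r subr0 => ek; apply: nKy.
    have [t t0 Kt] := unit_e y; have := KD _ _ Kt (KZ _ _ t0 Kk).
    by rewrite -ek scalerN addrC addKr.
  move=> ek; apply: nKy; have := KZ s^-1 _ _ (KD _ _ Kk Ke).
  rewrite invr_gt0 => /(_ s0); rewrite -[e in k + e]opprK ek opprB addrC subrK.
  by rewrite scaleVK.
pose P M := convex_cone (K1 `|` M) /\ ~ (K1 `|` M) (- e).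
have [F FP Ftot|M [[cA Ae] maxM]] := @Zorn_bigcup _ P.
  split; last first.
    by move=> [//|[X FX Xe]]; have [_] := FP _ FX; apply; right.
  split => [u v|c u c0] [uK|[X FX Xu]].
  - move=> [vK|[Y FY Yv]]; first by left; exact: cK1.1.
    have [[cY _] _] := FP _ FY.
    by have [|Yuv] := cY u v (or_introl uK) (or_intror Yv); [left|right; exists Y].
  - move=> [vK|[Y FY Yv]].
      have [[cX _] _] := FP _ FX.
      by have [|Xuv] := cX u v (or_intror Xu) (or_introl vK); [left|right; exists X].
    have [XY|YX] := Ftot _ _ FX FY.
      have [[cY _] _] := FP _ FY.
      by have [|Yuv] := cY u v (or_intror (XY _ Xu)) (or_intror Yv); [left|right; exists Y].
    have [[cX _] _] := FP _ FX.
    by have [|Xuv] := cX u v (or_intror Xu) (or_intror (YX _ Yv)); [left|right; exists X].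
  - by left; exact: cK1.2.
  - have [[_ cX] _] := FP _ FX.
    by have [|Xuv] := cX c u c0 (or_intror Xu); [left|right; exists X].
set A := K1 `|` M in cA Ae; have [AD AZ] := cA.
have A0 : A 0 by left; exact: K1K.
have ext v : ~ A v -> exists a (c : R), [/\ A a, 0 < c & - e = a + c%:C *: v].
  move=> nAv; pose B := [set u | exists a (c : R), [/\ A a, 0 <= c & u = a + c%:C *: v]].
  have AB : A `<=` B by move=> a Aa; exists a, 0; rewrite scale0r addr0.
  have cB : convex_cone B.
    split => [_ _ [k [s [Kk s0 ->]]] [l [t [Kl t0 ->]]]|c _ c0 [k [s [Kk s0 ->]]]].
      exists (k + l), (s + t); rewrite addr_ge0//; split => //; first exact: AD.
      by rewrite rmorphD scalerDl addrACA.
    exists (c%:C *: k), (c * s); rewrite (mulr_ge0 (ltW c0) s0); split => //; first exact: AZ.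
    by rewrite scalerDr scalerA -rmorphM.
  have MB : M `<` B.
    split; first by move=> u Mu; apply: AB; right.
    move=> BM; apply: nAv; right; apply: BM; exists 0, 1.
    by rewrite scale1r add0r ler01.
  have K1B : K1 `|` B = B.
    by apply/seteqP; split => [u [K1u|//]|u Bu]; [apply: AB; left|right].
  have := maxM _ MB; rewrite /P K1B => nB.
  have [a [c [Aa c0 ac]]] : B (- e) by apply: contrapT => nBe; apply: nB.
  exists a, c; split => //; rewrite lt_def c0 andbT; apply/eqP => cz.
  by apply: Ae; rewrite ac cz scale0r addr0.
exists A; split => //.
- by move=> k /K1K; left.
- by left; exists 0, 1; rewrite scale1r sub0r ler01.
- move=> v; apply: contrapT => /not_orP [/ext [a [c [Aa c0 ea]]] /ext [b [s [Ab s0 eb]]]].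
  have E : s%:C *: a + c%:C *: b = (s + c)%:C *: (- e).
    have -> : a = - e - c%:C *: v by rewrite ea addrK.
    have -> : b = - e + s%:C *: v by rewrite eb scalerN subrK.
    rewrite [LHS](_ : _ = s%:C *: - e + c%:C *: - e).
      by rewrite -scalerDl -rmorphD.
    rewrite scalerBr scalerDr !scalerA [_%:C * s%:C]mulrC addrACA addNr addr0 //.
  apply: Ae; have := AZ (s + c)^-1 _ _ (AD _ _ (AZ _ _ s0 Aa) (AZ _ _ c0 Ab)).
  by rewrite invr_gt0 E scaleVK ?addr_gt0//; exact.
Qed.

(** In a maximal cone avoiding [- e] every vector or its opposite lies, so that the cone
    is a half-space up to its boundary; the functional measures how far along [- e] a
    vector can be moved before leaving it. *)
Lemma cone_separation : ~ K y -> exists L : V -> R,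
  [/\ (forall u v, L (u + v) = L u + L v), (forall (c : R) u, L (c%:C *: u) = c * L u),
      (forall v, K v -> 0 <= L v), L y <= 0 & 0 < L e].
Proof.
move=> /maximal_cone [A [[AD AZ] KA Ay Ae Atot]].
have A0 : A 0 by exact: KA.
have AZe (t : R) : A (t%:C *: e) -> 0 <= t.
  move=> At; rewrite leNgt; apply/negP => t0; apply: Ae.
  have := AZ (- t)^-1 _ _ At; rewrite invr_gt0 oppr_gt0 => /(_ t0).
  by rewrite scalerA -rmorphM invrN mulNr mulVf ?lt_eqF// rmorphN scaleN1r.
have Aep (t : R) : 0 <= t -> A (t%:C *: e).
  rewrite le_eqVlt => /predU1P[<-|t0]; first by rewrite scale0r.
  by apply: AZ => //; exact: KA.
pose S v := [set t : R | A (v - t%:C *: e)].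
have Sub v s t : A (s%:C *: e - v) -> S v t -> t <= s.
  move=> As At; have := AD _ _ As At; rewrite addrA subrK -scalerBl -rmorphB => /AZe.
  by rewrite subr_ge0.
have Ssup v : has_sup (S v).
  split; last first.
    by have [s _ /KA As] := unit_e (- v); exists s => t; exact: Sub As.
  have [s _ /KA As] := unit_e v; exists (- s); rewrite /S /=.
  by rewrite rmorphN scaleNr opprK addrC.
pose L v := sup (S v).
have Lge v t : A (v - t%:C *: e) -> t <= L v.
  by move=> At; apply: sup_upper_bound => //; exact: Ssup.
have Lle v t : A (t%:C *: e - v) -> L v <= t.
  by move=> At; apply: ge_sup; [exact: (Ssup v).1|move=> s; exact: Sub].
have ltL v t : t < L v -> A (v - t%:C *: e).
  move=> tL; have [|s Ss] := @sup_adherent _ (S v) (L v - t) _ (Ssup v).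
    by rewrite subr_gt0.
  rewrite subKr => ts; have -> : v - t%:C *: e = (v - s%:C *: e) + (s - t)%:C *: e.
    by rewrite rmorphB scalerBl addrA subrK.
  by apply: AD => //; apply: Aep; rewrite subr_ge0 ltW.
have gtL v t : L v < t -> A (t%:C *: e - v).
  move=> tL; have [At|] := Atot (v - t%:C *: e); last by rewrite opprB.
  by have := Lge _ _ At; rewrite leNgt tL.
exists L; split.
- move=> u v; apply/eqP; rewrite eq_le; apply/andP; split.
    apply/ler_addgt0Pr => eps eps0; apply: Lle.
    rewrite (_ : _ + eps = (L u + eps / 2) + (L v + eps / 2)); last by lra.
    rewrite rmorphD scalerDl opprD addrACA.
    by apply: AD; apply: gtL; rewrite ltrDl divr_gt0.
  apply/ler_addgt0Pr => eps eps0; rewrite -lerBlDr; apply: Lge.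
  rewrite (_ : _ - eps = (L u - eps / 2) + (L v - eps / 2)); last by lra.
  rewrite rmorphD scalerDl opprD addrACA.
  by apply: AD; apply: ltL; rewrite ltrBlDr ltrDl divr_gt0.
- have Lpos c u : 0 < c -> L (c%:C *: u) = c * L u.
    move=> c0; apply/eqP; rewrite eq_le; apply/andP; split.
      apply/ler_addgt0Pr => eps eps0; apply: Lle.
      rewrite (_ : _ + eps = c * (L u + eps / c)); last by field; rewrite gt_eqF.
      rewrite rmorphM -scalerA -scalerBr; apply: AZ => //; apply: gtL.
      by rewrite ltrDl divr_gt0.
    apply/ler_addgt0Pr => eps eps0; rewrite -lerBlDr; apply: Lge.
    rewrite (_ : _ - eps = c * (L u - eps / c)); last by field; rewrite gt_eqF.
    rewrite rmorphM -scalerA -scalerBr; apply: AZ => //; apply: ltL.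
    by rewrite ltrBlDr ltrDl divr_gt0.
  have L0 : L 0 = 0.
    by have := Lpos _ 0 (ltr0Sn R 1); rewrite scaler0; lra.
  have LN u : L (- u) = - L u.
    apply/eqP; rewrite eq_le; apply/andP; split.
      apply/ler_addgt0Pr => eps eps0; apply: Lle; rewrite opprK.
      have := @ltL u (L u - eps); rewrite ltrBlDr ltrDl => /(_ eps0).
      by rewrite addrC -scaleNr -rmorphN opprB [- L u + _]addrC.
    apply/ler_addgt0Pr => eps eps0; rewrite -lerBlDr; apply: Lge.
    have := @gtL u (L u + eps); rewrite ltrDl => /(_ eps0).
    by rewrite addrC -[- L u - eps]opprD rmorphN scaleNr opprK.
  move=> c u; have [c0|c0|->] := ltgtP c 0; last by rewrite scale0r mul0r.
    have := Lpos (- c) u; rewrite oppr_gt0 rmorphN scaleNr LN mulNr => /(_ c0).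
    exact: oppr_inj.
  exact: Lpos.
- by move=> v /KA Av; apply: Lge; rewrite scale0r subr0.
- by apply: Lle; rewrite scale0r sub0r.
- by apply: lt_le_trans ltr01 _; apply: Lge; rewrite scale1r subrr.
Qed.

End cone_separation.

(** * Scalar convexity and duality *)

Section scalar_convexity.
Context {R : realType}.
Variables (J : set R) (theta : R -> R).
Hypothesis theta_convex : operator_convex J theta.

(** Operator convexity for matrices of size one. *)
Lemma operator_convex_scalar (x y t : R) : J x -> J y -> 0 <= t <= 1 ->
  theta ((1 - t) * x + t * y) <= (1 - t) * theta x + t * theta y.
Proof.
move=> Jx Jy t01.
have hx := @rdiag_selfadjoint_in _ 1 J (fun=> x) (fun=> Jx).
have hy := @rdiag_selfadjoint_in _ 1 J (fun=> y) (fun=> Jy).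
have := theta_convex t01 hx hy.
rewrite !rdiagZ rdiagD !mxfun_rdiag !rdiagZ rdiagD => /(_ (delta_mx 0 0)).
rewrite -/(qform _ _) qformB !qform_basis !mxE !eqxx !mulr1n -rmorphB.
by rewrite lecR subr_ge0.
Qed.

Lemma operator_convex_le (a b t c : R) : J a -> J b -> a <= t <= b ->
  theta a <= c -> theta b <= c -> theta t <= c.
Proof.
move=> Ja Jb /andP[at_ tb] ac bc; have [ab|ba] := ltP a b; last first.
  by rewrite (_ : t = a)//; apply/eqP; rewrite eq_le at_ (le_trans tb ba).
pose l := (t - a) / (b - a).
have /andP[l0 l1] : 0 <= l <= 1.
  apply/andP; split; first by apply: divr_ge0; rewrite subr_ge0// ltW.
  by rewrite ler_pdivrMr ?subr_gt0// mul1r lerD2r.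
have -> : t = (1 - l) * a + l * b by rewrite /l; field; rewrite subr_eq0 gt_eqF.
have l01 : 0 <= l <= 1 by rewrite l0.
apply: le_trans (operator_convex_scalar Ja Jb l01) _.
nra.
Qed.

(** The end points give an upper bound, and reflecting at the midpoint turns it into a
    lower bound. *)
Lemma operator_convex_bounded (a b : R) : `[a, b] `<=` J ->
  exists B : R, forall t, a <= t <= b -> `|theta t| <= B.
Proof.
move=> abJ; have [ab|ba] := leP a b; last first.
  by exists 0 => t /andP[a1 b1]; have := le_lt_trans (le_trans a1 b1) ba; rewrite ltxx.
have Ja : J a by apply: abJ; rewrite /= in_itv /= lexx ab.
have Jb : J b by apply: abJ; rewrite /= in_itv /= lexx ab.
pose M := `|theta a| + `|theta b|; pose c := 2^-1 * (a + b).
have up t : a <= t <= b -> theta t <= M.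
  move=> tab; apply: (operator_convex_le Ja Jb tab).
    by apply: le_trans (ler_norm _) _; rewrite lerDl.
  by apply: le_trans (ler_norm _) _; rewrite lerDr.
exists (2 * `|theta c| + M) => t tab.
have M0 : 0 <= M by rewrite addr_ge0.
rewrite ler_norml; apply/andP; split; last first.
  by apply: le_trans (up _ tab) _; rewrite lerDr mulr_ge0.
have tab' : a <= a + b - t <= b by move: tab => /andP[]; lra.
have Jt : J t by apply: abJ; rewrite /= in_itv.
have Jt' : J (a + b - t) by apply: abJ; rewrite /= in_itv.
have half : 0 <= (2^-1 : R) <= 1 by rewrite invr_ge0 ler0n invf_le1 ?ler1n.
have := operator_convex_scalar Jt Jt' half.
rewrite (_ : _ + 2^-1 * (a + b - t) = c); last by rewrite /c; field.
have := ler_norm (- theta c); rewrite normrN.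
have := up _ tab'; lra.
Qed.

End scalar_convexity.

Section duality.
Context {R : realType}.
Local Notation C := R[i].

Definition dual_cone {m n} (K : set 'M[C]_(m, n)) : set 'M[C]_(n, m) :=
  [set A | forall z, K z -> 0 <= complex.Re (\tr (A *m z))].

Lemma Re_tr_mulE m n (A : 'M[C]_(n, m)) (z : 'M[C]_(m, n)) :
  complex.Re (\tr (A *m z)) =
  \sum_i \sum_j (complex.Re (A j i) * complex.Re (z i j)
               - complex.Im (A j i) * complex.Im (z i j)).
Proof.
rewrite /mxtrace raddf_sum exchange_big /=; apply: eq_bigr => j _.
by rewrite mxE raddf_sum; apply: eq_bigr => i _; exact: cReM.
Qed.

Lemma real_functional_trace m n (L : 'M[C]_(m, n) -> R) :
  (forall u v, L (u + v) = L u + L v) -> (forall (c : R) u, L (c%:C *: u) = c * L u) ->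
  exists A : 'M[C]_(n, m), forall z, L z = complex.Re (\tr (A *m z)).
Proof.
move=> LD LZ.
exists (\matrix_(j, i) (L (delta_mx i j) +i* - L ('i%C *: delta_mx i j))) => z.
have L0 : L 0 = 0 by have := LZ 0 0; rewrite scaler0 mul0r.
have Lsum (I : finType) (F : I -> 'M[C]_(m, n)) : L (\sum_i F i) = \sum_i L (F i).
  by apply: (big_morph L LD L0).
rewrite Re_tr_mulE {1}(matrix_sum_delta z) Lsum; apply: eq_bigr => i _.
rewrite Lsum; apply: eq_bigr => j _; rewrite mxE /=.
rewrite {1}[z i j]complexE scalerDl LD LZ mulrC ['i%C * _]mulrC -scalerA LZ.
by rewrite mulNr opprK [X in _ + X]mulrC.
Qed.

(** Otherwise a functional separates the moved point from [K]: it is nonnegative on [K],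
    hence at [z], and positive at [e], but not positive at [z + eps e]. The order unit
    replaces the closedness of [K] in the bipolar theorem. *)
Lemma bidual_order_unit m n (K : set 'M[C]_(m, n)) (e z : 'M[C]_(m, n)) (eps : R) :
  convex_cone K -> K 0 ->
  (forall v, exists2 t : R, 0 < t & K (t%:C *: e + v)) ->
  (forall A, dual_cone K A -> 0 <= complex.Re (\tr (A *m z))) -> 0 < eps ->
  K (z + eps%:C *: e).
Proof.
move=> cK K0 unit_e zbid eps0; apply: contrapT => nK.
have [L [LD LZ LK Ly Le]] := cone_separation cK K0 unit_e nK.
have [A LA] := real_functional_trace LD LZ.
have : 0 <= L z by rewrite LA; apply: zbid => k Kk; rewrite -LA; exact: LK.
move: Ly; rewrite LD LZ; have := mulr_gt0 eps0 Le; lra.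
Qed.

End duality.

Section positive_matrices_bounds.
Context {R : realType}.
Local Notation C := R[i].

Lemma herm_lower_bound n (b : 'M[C]_n) : b \is hermsymmx ->
  exists M : R, forall t, M <= t -> psdmx (t%:C *: 1%:M + b).
Proof.
move=> hb; exists (\sum_i `|specval b i|) => t Mt.
have -> : t%:C *: 1%:M + b = mxfun (fun x => t + x) b.
  by rewrite (mxfunD (fun=> t) id) mxfun_cst (mxfun_id hb).
apply: psd_mxfun => i; rewrite -lerBlDr sub0r; apply: le_trans Mt.
rewrite (bigD1 i)//= -[X in X <= _]addr0 lerD//; last exact: sumr_ge0.
by rewrite -normrN ler_norm.
Qed.

(** Conjugation by the inverse of [s] reduces to the case of the identity, where it is
    enough to dominate the eigenvalues. *)
Lemma posdef_absorbs n (s b : 'M[C]_n) : s^t* = s -> s \in unitmx ->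
  b \is hermsymmx -> exists M : R, forall t, M <= t -> psdmx (t%:C *: (s *m s) + b).
Proof.
move=> sa su hb.
have sVa : (invmx s)^t* = invmx s.
  rewrite -[LHS]mulmx1 -(mulmxV su) mulmxA -[X in _ *m X *m _]sa -adjmxM.
  by rewrite (mulmxV su) adjmx1 mul1mx.
have [|M HM] := @herm_lower_bound n (invmx s *m b *m invmx s).
  by rewrite -{1}sVa; exact: hermmx_congr.
exists M => t /HM /(psdmx_congr s); rewrite sa.
rewrite mulmxDr mulmxDl -scalemxAr -scalemxAl mulmx1.
by rewrite !mulmxA (mulmxV su) mul1mx -mulmxA (mulVmx su) mulmx1.
Qed.

Definition hermpart {n} (a : 'M[C]_n) : 'M[C]_n := (2^-1)%:C *: (a + a^t*).

Lemma hermpart_herm n (a : 'M[C]_n) : hermpart a \is hermsymmx.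
Proof.
by apply: hermmxZ; apply/hermmxP; rewrite adjmxD adjmxK addrC.
Qed.

Lemma hermpart_id n (a : 'M[C]_n) : a \is hermsymmx -> hermpart a = a.
Proof.
move=> /hermmxP ha; rewrite /hermpart ha -[a in a + a]scale1r -scalerDl scalerA.
have -> : (1 + 1 : C) = (2 : R)%:C by rewrite -[2 : R]/(1 + 1) rmorphD rmorph1.
by rewrite -rmorphM mulVf ?scale1r// pnatr_eq0.
Qed.

Lemma hermpartD n (a b : 'M[C]_n) : hermpart (a + b) = hermpart a + hermpart b.
Proof. by rewrite /hermpart adjmxD addrACA scalerDr. Qed.

Lemma hermpartZ n (c : R) (a : 'M[C]_n) : hermpart (c%:C *: a) = c%:C *: hermpart a.
Proof.
rewrite /hermpart adjmxZ.
have -> : Num.conj c%:C = c%:C by exact: conjc_real.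
by rewrite -scalerDr !scalerA mulrC.
Qed.

End positive_matrices_bounds.

(** * The cone generated by scalar data *)

Section jensen_cone.
Context {R : realType}.
Local Notation C := R[i].
Variable theta : R -> R.

Definition triple {n} (g m p : 'M[C]_n) : 'M[C]_(n + (n + n), n) :=
  col_mx g (col_mx m p).

(** The rows [w_l] of [w] carry rank one blocks [w_l^* w_l], summed with the scalar weights
    1, [lam_l] and [theta lam_l]: these are the triples of a positive operator valued measure
    with finitely many atoms and a scalar function, up to a positive excess [q] in the
    last block. *)
Definition jensen_cone n (I : set R) : set 'M[C]_(n + (n + n), n) :=
  [set z | exists k (w : 'M[C]_(k, n)) (lam : 'I_k -> R) (q : 'M[C]_n),
    [/\ forall i, I (lam i), psdmx q &
        z = triple (w^t* *m w) (w^t* *m rdiag lam *m w)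
                   (w^t* *m rdiag (theta \o lam) *m w + q)]].

Lemma tripleD n (g m p g' m' p' : 'M[C]_n) :
  triple g m p + triple g' m' p' = triple (g + g') (m + m') (p + p').
Proof. by rewrite /triple !add_col_mx. Qed.

Lemma tripleZ n c (g m p : 'M[C]_n) :
  c *: triple g m p = triple (c *: g) (c *: m) (c *: p).
Proof. by rewrite /triple !scale_col_mx. Qed.

Lemma eq_triple n (g m p g' m' p' : 'M[C]_n) :
  triple g m p = triple g' m' p' -> [/\ g = g', m = m' & p = p'].
Proof. by move=> /eq_col_mx [-> /eq_col_mx [-> ->]]. Qed.

Lemma gramE n k (w : 'M[C]_(k, n)) (f : 'I_k -> R) i j :
  (w^t* *m rdiag f *m w) i j = \sum_l Num.conj (w l i) * w l j * (f l)%:C.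
Proof.
by rewrite mxE; apply: eq_bigr => l _; rewrite mul_rdiagE !mxE mulrAC.
Qed.

Lemma jensen_cone0 n (I : set R) : jensen_cone I (0 : 'M[C]_(n + (n + n), n)).
Proof.
exists 0, 0, (fun=> 0), 0; split; [by case|exact: psdmx0|].
by rewrite /triple !mulmx0 addr0 !col_mx0.
Qed.

Lemma jensen_cone_convex n (I : set R) : convex_cone (@jensen_cone n I).
Proof.
split => [_ _ [k [w [lam [q [Il pq ->]]]]] [l [w' [lam' [q' [Il' pq' ->]]]]]|
          c _ c0 [k [w [lam [q [Il pq ->]]]]]].
  pose mu i := match fintype.split i with inl j => lam j | inr j => lam' j end.
  exists (k + l)%N, (col_mx w w'), mu, (q + q'); split; last 1 first.
  - have E (f : R -> R) : (col_mx w w')^t* *m rdiag (f \o mu) *m col_mx w w' =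
        w^t* *m rdiag (f \o lam) *m w + w'^t* *m rdiag (f \o lam') *m w'.
      apply/matrixP => i j; rewrite [RHS]mxE !gramE big_split_ord; congr (_ + _).
        apply: eq_bigr => a _; rewrite !col_mxEu /mu /=.
        by case: split_ordP => b /eqP; rewrite ?eq_lshift ?eq_lrshift// => /eqP ->.
      apply: eq_bigr => a _; rewrite !col_mxEd /mu /=.
      by case: split_ordP => b /eqP; rewrite ?eq_rshift ?eq_rlshift// => /eqP ->.
    have /= Eid := E id; rewrite tripleD [X in _ = triple _ X _]Eid (E theta) addrACA.
    congr triple.
    by have := E (fun=> 1); rewrite ![rdiag _]rdiag1 !mulmx1.
  - by move=> i; rewrite /mu; case: fintype.split.
  - exact: psdmxD.
exists k, ((Num.sqrt c)%:C *: w), lam, (c%:C *: q); split => //.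
  by apply: psdmxZ => //; rewrite lecR ltW.
have E (d : 'M[C]_k) : ((Num.sqrt c)%:C *: w)^t* *m d *m ((Num.sqrt c)%:C *: w) =
    c%:C *: (w^t* *m d *m w).
  rewrite adjmxZ; have -> : Num.conj (Num.sqrt c)%:C = (Num.sqrt c)%:C :> C.
    exact: conjc_real.
  by rewrite -!scalemxAl -scalemxAr scalerA -rmorphM -expr2 sqr_sqrtr// ltW.
rewrite tripleZ !E scalerDr; congr triple.
by have := E 1%:M; rewrite !mulmx1.
Qed.

Lemma jensen_cone_point n (I : set R) (lam : R) (s q : 'M[C]_n) :
  I lam -> psdmx s -> psdmx q ->
  jensen_cone I (triple s (lam%:C *: s) ((theta lam)%:C *: s + q)).
Proof.
move=> Il ps pq; exists n, (sqrtmx s), (fun=> lam), q; split => //.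
have sa : (sqrtmx s)^t* = sqrtmx s by apply/hermmxP/sqrtmx_herm.
have E c : (sqrtmx s)^t* *m rdiag (fun=> c) *m sqrtmx s = c%:C *: s.
  have -> : rdiag (fun=> c) = c%:C *: 1%:M :> 'M[C]_n.
    by rewrite -rdiag1 rdiagZ; congr rdiag; apply/funext => i; rewrite mulr1.
  by rewrite -scalemxAr -scalemxAl mulmx1 sa sqrtmxK.
by rewrite E (E (theta lam)) sa sqrtmxK.
Qed.

Lemma jensen_coneS n (I I' : set R) : I `<=` I' -> @jensen_cone n I `<=` @jensen_cone n I'.
Proof.
by move=> II' _ [k [w [lam [q [Il pq ->]]]]]; exists k, w, lam, q; split => // i; exact: II'.
Qed.

Lemma jensen_cone_herm n (I : set R) (g m p : 'M[C]_n) :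
  jensen_cone I (triple g m p) ->
  [/\ g \is hermsymmx, m \is hermsymmx & p \is hermsymmx].
Proof.
move=> [k [w [lam [q [_ pq /eq_triple [-> -> ->]]]]]]; split.
- exact/psdmx_herm/psdmx_gram.
- exact/hermmx_congr/rdiag_herm.
- by apply: hermmxD; [exact/hermmx_congr/rdiag_herm|exact: psdmx_herm].
Qed.

(** The scalars [a] and [b] alone generate every triple that lies above the chord of
    [theta], a condition linear in [g], [m] and [p]; where the three inequalities are
    strict the triple is interior to the cone. *)
Lemma jensen_cone_chord n (a b : R) (g m p : 'M[C]_n) : a < b ->
  let s := ((b - a)^-1)%:C *: (b%:C *: g - m) in
  let t := ((b - a)^-1)%:C *: (m - a%:C *: g) in
  psdmx (b%:C *: g - m) -> psdmx (m - a%:C *: g) ->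
  psdmx (p - ((theta a)%:C *: s + (theta b)%:C *: t)) ->
  jensen_cone `[a, b] (triple g m p).
Proof.
move=> ab s t ps pt pp.
have c0 : 0 <= ((b - a)^-1)%:C :> C by rewrite lecR invr_ge0 subr_ge0 ltW.
have [JD _] := @jensen_cone_convex n `[a, b].
have Ia : `[a, b]%classic a by rewrite /= in_itv /= lexx ltW.
have Ib : `[a, b]%classic b by rewrite /= in_itv /= lexx ltW.
have := JD _ _ (jensen_cone_point Ia (psdmxZ c0 ps) pp)
  (jensen_cone_point Ib (psdmxZ c0 pt) (@psdmx0 _ n)).
have u : (b - a)^-1 * (b - a) = 1 by rewrite mulVf// subr_eq0 gt_eqF.
rewrite tripleD -/s -/t addr0.
have -> : s + t = g.
  by rewrite -scalerDr addrA subrK -scalerBl -rmorphB scalerA -rmorphM u scale1r.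
have -> : a%:C *: s + b%:C *: t = m.
  transitivity (((b - a)^-1 * (b - a))%:C *: m); last by rewrite u scale1r.
  apply/matrixP => i j; rewrite !mxE rmorphM rmorphB; ring.
by rewrite addrAC addrC subrK.
Qed.

(** Diagonalizing [a] splits the triple into rank one blocks carried by the eigenvalues
    of [a]. *)
Lemma jensen_cone_congr n (I : set R) (s a : 'M[C]_n) :
  s^t* = s -> selfadjoint_in I a ->
  jensen_cone I (triple (s *m s) (s *m a *m s) (s *m mxfun theta a *m s)).
Proof.
move=> sa [ha Ia]; pose u := spectralmx a.
have e D : (u *m s)^t* *m D *m (u *m s) = s *m (u^t* *m D *m u) *m s.
  by rewrite adjmxM sa !mulmxA.
have e1 : (u *m s)^t* *m (u *m s) = s *m s.
  rewrite adjmxM sa !mulmxA -(mulmxA s (u^t*) u) (spectralmxVK a).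
  by rewrite mulmx1.
exists n, (u *m s), (specval a), 0; split.
- by move=> i; exact: (spectrum_specval i ha Ia).
- exact: psdmx0.
- by rewrite e1 (e (rdiag (specval a))) (e (rdiag (theta \o specval a))) addr0
    -mxfunE -(spectral_decomposition ha).
Qed.

End jensen_cone.

(** * Jensen's inequality on the bidual cone *)

Section bidual.
Context {R : realType}.
Local Notation C := R[i].
Variable theta : R -> R.

(** Positivity of a combination of blocks is expressed by the functionals
    [kap * qform _ v] with [0 <= Re kap], which are nonnegative on the cone. *)
Lemma bidual_psd n (I : set R) (c1 c2 c3 : R) (g m p : 'M[C]_n) :
  (forall g' m' p' : 'M[C]_n, jensen_cone theta I (triple g' m' p') ->
     psdmx (c1%:C *: g' + c2%:C *: m' + c3%:C *: p')) ->
  (forall A, dual_cone (@jensen_cone _ theta n I) A ->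
     0 <= complex.Re (\tr (A *m triple g m p))) ->
  psdmx (c1%:C *: g + c2%:C *: m + c3%:C *: p).
Proof.
move=> Kpos zbid v.
pose A (kap : C) : 'M[C]_(n, n + (n + n)) := row_mx ((kap * c1%:C) *: (v *m v^t*))
  (row_mx ((kap * c2%:C) *: (v *m v^t*)) ((kap * c3%:C) *: (v *m v^t*))).
have trA kap g' m' p' : \tr (A kap *m triple g' m' p') =
    kap * qform (c1%:C *: g' + c2%:C *: m' + c3%:C *: p') v.
  rewrite /A /triple !mul_row_col -!scalemxAl !mxtraceD !mxtraceZ -!qform_tr.
  by rewrite !qformD !qformZ !mulrDr !mulrA addrA.
have Adual kap : 0 <= complex.Re kap -> 0 <= complex.Re (kap *
    qform (c1%:C *: g + c2%:C *: m + c3%:C *: p) v).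
  move=> kap0; rewrite -trA; apply: zbid => z Kz.
  have [g' [m' [p' zE]]] : exists g' m' p', z = triple g' m' p'.
    by exists (usubmx z), (usubmx (dsubmx z)), (dsubmx (dsubmx z)); rewrite /triple !vsubmxK.
  rewrite zE in Kz *; rewrite trA.
  exact: ((ge0_Re_mulP _).1 (Kpos _ _ _ Kz v)).
exact/ge0_Re_mulP.
Qed.

Variable J : set R.
Hypothesis theta_convex : operator_convex J theta.

(** Enlarging the interval on both sides makes the inequalities of [jensen_cone_chord]
    strict at [g] and [m]. These two blocks are kept in the order unit because [theta] is
    evaluated at [s^-1 m s^-1], which is left unchanged when both are scaled. *)
Lemma jensen_cone_order_unit n (a b a' b' : R) (s m : 'M[C]_n) :
  a' < a -> a <= b -> b < b' ->
  s^t* = s -> s \in unitmx -> let g := s *m s in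
  psdmx (m - a%:C *: g) -> psdmx (b%:C *: g - m) ->
  exists q, q \is hermsymmx /\ forall x y r : 'M[C]_n,
    x \is hermsymmx -> y \is hermsymmx -> r \is hermsymmx ->
    exists2 t : R, 0 < t &
      jensen_cone theta `[a', b'] (t%:C *: triple g m q + triple x y r).
Proof.
move=> a'a ab bb' sa su g pma pbm.
have gpsd : psdmx g by rewrite /g -{1}sa; exact: psdmx_gram.
have hg := psdmx_herm gpsd.
have hm : m \is hermsymmx.
  by have := hermmxD (psdmx_herm pma) (hermmxZ a hg); rewrite subrK.
have a'b' : a' < b' by apply: lt_trans a'a _; exact: le_lt_trans bb'.
pose chord (g m : 'M[C]_n) :=
  (theta a')%:C *: (((b' - a')^-1)%:C *: (b'%:C *: g - m)) +
  (theta b')%:C *: (((b' - a')^-1)%:C *: (m - a'%:C *: g)).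
have hchord x y : x \is hermsymmx -> y \is hermsymmx -> chord x y \is hermsymmx.
  move=> hx hy; apply: hermmxD; apply: hermmxZ; apply: hermmxZ.
    exact: (hermmxB (hermmxZ b' hx) hy).
  exact: (hermmxB hy (hermmxZ a' hx)).
have chordD x y x' y' : chord (x + x') (y + y') = chord x y + chord x' y'.
  by apply/matrixP => i j; rewrite /chord !mxE; ring.
have chordZ (c : R) x y : chord (c%:C *: x) (c%:C *: y) = c%:C *: chord x y.
  by apply/matrixP => i j; rewrite /chord !mxE; ring.
exists (chord g m + g); split; first exact: (hermmxD (hchord _ _ hg hm) hg).
move=> x y r hx hy hr.
have [T1 H1] := posdef_absorbs sa su (hermmxB (hermmxZ b' hx) hy).
have [T2 H2] := posdef_absorbs sa su (hermmxB hy (hermmxZ a' hx)).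
have [T3 H3] := posdef_absorbs sa su (hermmxB hr (hchord _ _ hx hy)).
(* One summand for each inequality of the chord lemma, scaled by the room it has: the
   excess [g] in the order unit is the room of the third one. *)
pose t := 1 + `|T1| / (b' - b) + `|T2| / (a - a') + `|T3|.
have d1 : 0 <= `|T1| / (b' - b) by rewrite divr_ge0// subr_ge0 ltW.
have d2 : 0 <= `|T2| / (a - a') by rewrite divr_ge0// subr_ge0 ltW.
have d3 := normr_ge0 T3.
have t0 : 0 < t by rewrite /t; lra.
have t0C : 0 <= t%:C :> C by rewrite lecR ltW.
have tT1 : T1 <= t * (b' - b).
  apply: le_trans (ler_norm _) _; rewrite -ler_pdivrMr ?subr_gt0//.
  by rewrite /t; lra.
have tT2 : T2 <= t * (a - a').
  apply: le_trans (ler_norm _) _; rewrite -ler_pdivrMr ?subr_gt0//.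
  by rewrite /t; lra.
have tT3 : T3 <= t by apply: le_trans (ler_norm _) _; rewrite /t; lra.
exists t; first exact: t0.
rewrite tripleZ tripleD; apply: jensen_cone_chord; first exact: a'b'.
- have -> : b'%:C *: (t%:C *: g + x) - (t%:C *: m + y) =
    ((t * (b' - b))%:C *: g + (b'%:C *: x - y)) + t%:C *: (b%:C *: g - m).
    apply/matrixP => i j; rewrite !mxE !rmorphM rmorphB; ring.
  by apply: psdmxD; [exact: H1|exact: psdmxZ].
- have -> : (t%:C *: m + y) - a'%:C *: (t%:C *: g + x) =
    ((t * (a - a'))%:C *: g + (y - a'%:C *: x)) + t%:C *: (m - a%:C *: g).
    apply/matrixP => i j; rewrite !mxE !rmorphM rmorphB; ring.
  by apply: psdmxD; [exact: H2|exact: psdmxZ].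
- rewrite -/(chord _ _) chordD chordZ scalerDr opprD -(addrA (_ *: chord g m)).
  by rewrite addrACA subrr add0r -addrA; exact: H3.
Qed.

(** The bidual gives spectral bounds for [phi] directly. Moved along the order unit
    [(g, m, q)], the triple enters the cone with its first two blocks multiplied by [1 + eps],
    so it is still [phi] that appears in Jensen's inequality; [eps] remains in scalar
    factors only, and it tends to 0 in each quadratic form. *)
Lemma bidual_jensen n (alpha beta : R) (s phi phi_theta : 'M[C]_n) :
  open J -> is_interval J -> alpha <= beta -> `[alpha, beta] `<=` J ->
  s^t* = s -> s \in unitmx ->
  (forall A, dual_cone (@jensen_cone _ theta n `[alpha, beta]) A ->
     0 <= complex.Re (\tr (A *m triple (s *m s) (s *m phi *m s) (s *m phi_theta *m s)))) ->
  selfadjoint_in J phi /\ lownerle (mxfun theta phi) phi_theta.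
Proof.
move=> openJ intJ ab abJ sa su zbid.
set g := s *m s in zbid; set m := s *m phi *m s in zbid.
set p := s *m phi_theta *m s in zbid.
have Ja : J alpha by apply: abJ; rewrite /= in_itv /= lexx ab.
have Jb : J beta by apply: abJ; rewrite /= in_itv /= lexx ab.
have [B HB] := operator_convex_bounded theta_convex abJ.
have gram_pos k (w : 'M[C]_(k, n)) (f : 'I_k -> R) (c : R) :
    c%:C *: (w^t* *m w) + w^t* *m rdiag f *m w = w^t* *m rdiag (fun i => c + f i) *m w.
  rewrite -rdiagD mulmxDr mulmxDl; congr (_ + _).
  have -> : rdiag (fun=> c) = c%:C *: 1%:M :> 'M[C]_k.
    by rewrite -rdiag1 rdiagZ; congr rdiag; apply/funext => i; rewrite mulr1.
  by rewrite -scalemxAr -scalemxAl mulmx1.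
have pma : psdmx (m - alpha%:C *: g).
  have -> : m - alpha%:C *: g = (- alpha)%:C *: g + (1 : R)%:C *: m + (0 : R)%:C *: p.
    by rewrite scale0r addr0 scale1r rmorphN scaleNr addrC.
  apply: bidual_psd zbid => g' m' p' [k [w [lam [q [Il pq /eq_triple [-> -> _]]]]]].
  rewrite scale0r addr0 scale1r gram_pos; apply/psdmx_congr/psd_rdiag => i.
  by have /= := Il i; rewrite in_itv /= => /andP[]; lra.
have pbm : psdmx (beta%:C *: g - m).
  have -> : beta%:C *: g - m = beta%:C *: g + (-1 : R)%:C *: m + (0 : R)%:C *: p.
    by rewrite scale0r addr0 rmorphN1 scaleN1r.
  apply: bidual_psd zbid => g' m' p' [k [w [lam [q [Il pq /eq_triple [-> -> _]]]]]].
  rewrite scale0r addr0 [(-1)%:C *: _]scalemxAl [(-1)%:C *: _]scalemxAr rdiagZ.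
  rewrite gram_pos; apply/psdmx_congr/psd_rdiag => i.
  by have /= := Il i; rewrite in_itv /= => /andP[]; lra.
(* The lower bound of [theta] shows that [p] is Hermitian. *)
have ppB : psdmx (p + B%:C *: g).
  have -> : p + B%:C *: g = B%:C *: g + (0 : R)%:C *: m + (1 : R)%:C *: p.
    by rewrite scale0r addr0 scale1r addrC.
  apply: bidual_psd zbid => g' m' p' [k [w [lam [q [Il pq /eq_triple [-> -> ->]]]]]].
  rewrite scale0r addr0 scale1r addrA gram_pos; apply: (psdmxD _ pq).
  apply/psdmx_congr/psd_rdiag => i /=.
  by have /= := Il i; rewrite in_itv /= => /HB; rewrite ler_norml => /andP[]; lra.
have gpsd : psdmx g by rewrite /g -{1}sa; exact: psdmx_gram.
have hg := psdmx_herm gpsd.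
have hm : m \is hermsymmx.
  by have := hermmxD (psdmx_herm pma) (hermmxZ alpha hg); rewrite subrK.
have hp : p \is hermsymmx.
  by have := hermmxB (psdmx_herm ppB) (hermmxZ B hg); rewrite addrK.
pose r := invmx s.
have sr : s *m r = 1%:M by exact: mulmxV.
have rs : r *m s = 1%:M by exact: mulVmx.
have ra : r^t* = r.
  by rewrite -[LHS]mulmx1 -sr mulmxA -[X in _ *m X *m _]sa -adjmxM sr adjmx1 mul1mx.
have congr_r (a : 'M[C]_n) : r *m (s *m a *m s) *m r = a.
  by rewrite !mulmxA rs mul1mx -mulmxA sr mulmx1.
have rgr : r *m g *m r = 1%:M by rewrite /g !mulmxA rs mul1mx sr.
have phi_in : selfadjoint_in `[alpha, beta] phi.
  apply: psd_spectrum.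
    have := psdmx_congr r pma; rewrite ra mulmxBr mulmxBl congr_r.
    by rewrite -scalemxAr -scalemxAl rgr.
  have := psdmx_congr r pbm; rewrite ra mulmxBr mulmxBl congr_r.
  by rewrite -scalemxAr -scalemxAl rgr.
split.
  by split; [exact: phi_in.1|move=> z /phi_in.2 [t /abJ]; exists t].
(* Room around the spectrum inside [J], for the order unit. *)
have [a' a'a Ja'] : exists2 a', a' < alpha & J a'.
  have /nbhs_ballP[e /= e0 He] := open_nbhs_nbhs (conj openJ Ja).
  exists (alpha - e / 2); first by rewrite ltrBlDr ltrDl divr_gt0.
  by apply: He; rewrite /ball /= subKr gtr0_norm ?divr_gt0//; lra.
have [b' bb' Jb'] : exists2 b', beta < b' & J b'.
  have /nbhs_ballP[e /= e0 He] := open_nbhs_nbhs (conj openJ Jb).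
  exists (beta + e / 2); first by rewrite ltrDl divr_gt0.
  by apply: He; rewrite /ball /= opprD addNKr normrN gtr0_norm ?divr_gt0//; lra.
have JI : `[a', b'] `<=` J by move=> t /=; rewrite in_itv /= => /intJ; exact.
have [q [hq q_unit]] := jensen_cone_order_unit a'a ab bb' sa su pma pbm.
(* The order unit absorbs Hermitian directions only; the cone is therefore saturated
   by all triples whose Hermitian part vanishes. *)
pose hp3 (z : 'M[C]_(n + (n + n), n)) := triple (hermpart (usubmx z))
  (hermpart (usubmx (dsubmx z))) (hermpart (dsubmx (dsubmx z))).
have hp3D z z' : hp3 (z + z') = hp3 z + hp3 z'.
  by rewrite /hp3 !linearD /= !hermpartD tripleD.
have hp3Z (c : R) z : hp3 (c%:C *: z) = c%:C *: hp3 z.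
  by rewrite /hp3 !linearZ /= !hermpartZ tripleZ.
have hp3_id g' m' p' : g' \is hermsymmx -> m' \is hermsymmx -> p' \is hermsymmx ->
    hp3 (triple g' m' p') = triple g' m' p'.
  move=> hg' hm' hp'; rewrite /hp3 /triple !col_mxKd !col_mxKu.
  by rewrite (hermpart_id hg') (hermpart_id hm') (hermpart_id hp').
pose K := [set z | jensen_cone theta `[a', b'] (hp3 z)].
have [JD JZ] := @jensen_cone_convex _ theta n `[a', b'].
have cK : convex_cone K.
  split=> [u v Ku Kv|c u c0 Ku].
    by have := JD _ _ Ku Kv; rewrite -hp3D; exact.
  by have := JZ _ _ c0 Ku; rewrite -hp3Z; exact.
have K0 : K 0.
  have e0 : hp3 0 = 0 by have := hp3Z 0 0; rewrite scaler0 rmorph0 scale0r.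
  by rewrite -[K 0]/(jensen_cone theta `[a', b'] (hp3 0)) e0; exact: jensen_cone0.
have unitK v : exists2 t : R, 0 < t & K (t%:C *: triple g m q + v).
  have [t t0 Kt] := q_unit _ _ _ (hermpart_herm (usubmx v))
    (hermpart_herm (usubmx (dsubmx v))) (hermpart_herm (dsubmx (dsubmx v))).
  exists t; first exact: t0.
  rewrite -[K _]/(jensen_cone theta `[a', b'] (hp3 _)) hp3D hp3Z (hp3_id _ _ _ hg hm hq).
  exact: Kt.
have zbidK A : dual_cone K A -> 0 <= complex.Re (\tr (A *m triple g m p)).
  move=> dA; apply: zbid => z Kz; apply: dA; move: (Kz).
  have zE : z = triple (usubmx z) (usubmx (dsubmx z)) (dsubmx (dsubmx z)).
    by rewrite /triple !vsubmxK.
  have [h1 h2 h3] : [/\ usubmx z \is hermsymmx, usubmx (dsubmx z) \is hermsymmx &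
      dsubmx (dsubmx z) \is hermsymmx].
    by apply: (@jensen_cone_herm _ theta _ `[alpha, beta]); rewrite -zE.
  rewrite {1}zE -(hp3_id _ _ _ h1 h2 h3) -zE; apply: jensen_coneS => t /=.
  rewrite !in_itv /= => /andP[at_ tb].
  by rewrite (le_trans (ltW a'a) at_) (le_trans tb (ltW bb')).
have step (eps : R) : 0 < eps ->
    psdmx (phi_theta - mxfun theta phi + eps%:C *: (r *m q *m r - mxfun theta phi)).
  move=> eps0; have := bidual_order_unit cK K0 unitK zbidK eps0.
  rewrite tripleZ tripleD.
  rewrite -[K _]/(jensen_cone theta `[a', b'] (hp3 _)).
  rewrite (hp3_id _ _ _ (hermmxD hg (hermmxZ eps hg)) (hermmxD hm (hermmxZ eps hm))
                        (hermmxD hp (hermmxZ eps hq))).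
  move=> [k [w [lam [q' [Il pq' /eq_triple [wg wm wp]]]]]].
  have e1 : 0 < 1 + eps by rewrite addr_gt0.
  pose c : R := Num.sqrt (1 + eps)^-1.
  have cc : c * c = (1 + eps)^-1 by rewrite -expr2 sqr_sqrtr// invr_ge0 ltW.
  pose v := c%:C *: (w *m r).
  have vE (d : 'M[C]_k) : v^t* *m d *m v = ((1 + eps)^-1)%:C *: (r *m (w^t* *m d *m w) *m r).
    rewrite adjmxZ adjmxM ra; have -> : Num.conj c%:C = c%:C :> C by exact: conjc_real.
    by rewrite -!scalemxAl -scalemxAr scalerA -rmorphM cc !mulmxA.
  have e1V : ((1 + eps)^-1)%:C * (1 + eps%:C) = 1 :> C.
    have -> : 1 + eps%:C = (1 + eps)%:C :> C by rewrite rmorphD rmorph1.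
    by rewrite -rmorphM mulVf ?gt_eqF.
  have geps (a : 'M[C]_n) : ((1 + eps)^-1)%:C *: (r *m (a + eps%:C *: a) *m r) = r *m a *m r.
    rewrite -{1}[a]scale1r -scalerDl -scalemxAr -scalemxAl scalerA e1V.
    by rewrite scale1r.
  have vv : v^t* *m v = 1%:M by rewrite -[v^t*]mulmx1 vE mulmx1 -wg geps rgr.
  have := jensen_compression theta_convex vv (fun i => JI _ (Il i)).
  rewrite !vE -wm geps congr_r => /(psdmxZ (ltW (_ : 0 < (1 + eps)%:C :> C))).
  rewrite ltcR => /(_ e1) /psdmxD /(_ (psdmx_congr r pq')); congr psdmx.
  rewrite ra scalerBr scalerA -rmorphM mulfV ?gt_eqF// scale1r.
  rewrite addrAC -mulmxDl -mulmxDr -wp mulmxDr mulmxDl congr_r -scalemxAr -scalemxAl.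
  by rewrite rmorphD rmorph1 scalerDl scale1r scalerBr opprD addrACA.
move=> v; rewrite -/(qform _ v).
have key eps : 0 < eps -> 0 <= qform (phi_theta - mxfun theta phi) v +
     eps%:C * qform (r *m q *m r - mxfun theta phi) v.
  by move=> /step /(_ v); rewrite -/(qform _ v) qformD qformZ.
move: key; case: (qform (phi_theta - _) v) => x y; case: (qform _ v) => x' y' key.
have yy' : y = 0.
  have := key 1 ltr01; have := key 2 (ltr0Sn R 1).
  rewrite !lecE /= => /andP[/eqP h1 _] /andP[/eqP h2 _]; lra.
rewrite lecE /= yy' eqxx /=; apply/ler_addgt0Pr => eps eps0.
pose d := eps / (1 + `|x'|).
have n0 := normr_ge0 x'.
have d0 : 0 < d by rewrite divr_gt0//; lra.
have := key d d0; rewrite lecE /= => /andP[_].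
have : d * `|x'| <= eps.
  rewrite /d mulrAC ler_pdivrMr; last by lra.
  by rewrite ler_pM2l//; lra.
have := ler_norm x'; nra.
Qed.

End bidual.

(** * Almost everywhere positivity *)

Section almost_everywhere.
Context d (T : measurableType d) (R : realType).
Variable mu : {measure set T -> \bar R}.

Lemma Rintegral_sum (I : finType) (w : I -> R) (f : I -> T -> R) (E : set T) :
  measurable E -> (forall i, mu.-integrable setT (EFin \o f i)) ->
  mu.-integrable E (EFin \o (fun x => \sum_i w i * f i x)) /\
  \int[mu]_(x in E) (\sum_i w i * f i x) = \sum_i w i * \int[mu]_(x in E) f i x.
Proof.
move=> mE intf.
have intE i : mu.-integrable E (EFin \o f i).
  by apply: integrableS (intf i).
have intw i : mu.-integrable E (EFin \o (fun x => w i * f i x)).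
  by apply: eq_integrable (integrableZl mE (w i) (intE i)).
elim: (index_enum I) => [|i s [int_s IHs]].
  split; first by apply: eq_integrable (integrable0 _ _) => // x _; rewrite /= big_nil.
  rewrite big_nil; under eq_Rintegral do rewrite big_nil.
  by rewrite Rintegral_cst// mul0r.
split.
  apply: eq_integrable (integrableD mE (intw i) int_s) => // x _.
  by rewrite /= big_cons.
rewrite big_cons -IHs -RintegralZl// -RintegralD//.
by under eq_Rintegral do rewrite big_cons.
Qed.

(** A value violating one of the inequalities lies in a rational box on which the same
    weight is negative throughout. There are countably many such boxes, and integrating
    over the preimage of one of them against that weight shows that it is null. *)
Lemma ae_dual_nonneg (I : finType) (f : I -> T -> R) (D : set (I -> R)) :
  (forall i, mu.-integrable setT (EFin \o f i)) ->
  (forall w E, D w -> measurable E -> 0 <= \sum_i w i * \int[mu]_(x in E) f i x) ->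
  exists N, [/\ measurable N, mu N = 0%E &
    forall x, ~ N x -> forall w, D w -> 0 <= \sum_i w i * f i x].
Proof.
move=> intf Df.
pose box (j : {ffun I -> rat} * nat) :=
  [set x | forall i, `|f i x - ratr (j.1 i)| < j.2.+1%:R^-1].
pose bad (j : {ffun I -> rat} * nat) := exists2 w, D w &
  forall y : I -> R, (forall i, `|y i - ratr (j.1 i)| < j.2.+1%:R^-1) ->
    \sum_i w i * y i < 0.
have mbox j : measurable (box j).
  have -> : box j = \bigcap_(i in setT)
      ((fun x => `|f i x - ratr (j.1 i)|) @^-1` `]-oo, j.2.+1%:R^-1[).
    apply/seteqP; split => x /= bx i; last by have := bx i Logic.I; rewrite /= in_itv.
    by move=> _; rewrite /= in_itv /= bx.
  apply: fin_bigcap_measurable => // i _; rewrite -[X in measurable X]setTI.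
  have /measurable_EFinP mf := measurable_int mu (intf i).
  have mg : measurable_fun setT (fun x => `|f i x - ratr (j.1 i)|).
    apply: measurableT_comp => //; apply: measurable_funB => //.
  by apply: mg => //; exact: measurable_itv.
have null_box j : bad j -> mu (box j) = 0%E.
  move=> [w Dw w0]; have [intE intEE] := Rintegral_sum w (mbox j) intf.
  have := Df _ _ Dw (mbox j); rewrite -intEE => ge0.
  have neg x : box j x -> \sum_i w i * f i x < 0 by exact: w0.
  pose g x := - \sum_i w i * f i x.
  have intg : mu.-integrable (box j) (EFin \o g).
    by apply: eq_integrable (integrableN intE).
  have g0 : (\int[mu]_(x in box j) `|(g x)%:E| = 0)%E.
    have -> : (\int[mu]_(x in box j) `|(g x)%:E| = \int[mu]_(x in box j) (g x)%:E)%E.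
      apply: eq_integral => x; rewrite inE => /neg gx.
      by rewrite gee0_abs// lee_fin /g oppr_ge0 ltW.
    have gf := integrable_fin_num (mbox j) intg.
    rewrite -(fineK gf); congr EFin; apply/eqP; rewrite eq_le; apply/andP; split.
      have -> : fine (\int[mu]_(x in box j) (g x)%:E) =
          -1 * \int[mu]_(x in box j) (\sum_i w i * f i x).
        rewrite -RintegralZl//; apply: eq_Rintegral => x _.
        by rewrite /g mulN1r.
      by rewrite mulN1r oppr_le0.
    by apply: Rintegral_ge0 => x /neg gx; rewrite /g oppr_ge0 ltW.
  have := (ae_eq_integral_abs mu (mbox j) (measurable_int mu intg)).1 g0.
  move=> [N [mN N0 sub]]; apply: (@subset_measure0 _ _ _ mu _ N) => // x bx; apply: sub => /=.
  move=> /(_ bx) [] /eqP; rewrite oppr_eq0 => /eqP gx.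
  by have := neg _ bx; rewrite gx ltxx.
pose G n := if unpickle n is Some j then
  (if `[< bad j >] then box j else set0) else set0.
have : mu.-negligible (\bigcup_n G n).
  apply: negligible_bigcup => n; rewrite /G; case: unpickle => [j|]; last exact: negligible_set0.
  case: asboolP => [bj|_]; last exact: negligible_set0.
  exists (box j); split => //; exact: null_box.
move=> [N [mN N0 sub]]; exists N; split => // x nNx w Dw.
rewrite leNgt; apply/negP => w0; apply: nNx; apply: sub.
pose S := 1 + \sum_i `|w i|; pose a := - \sum_i w i * f i x.
have a0 : 0 < a by rewrite /a oppr_gt0.
have S0 : 0 < S by rewrite /S ltr_pwDl// sumr_ge0.
have [k kP] : exists k : nat, 2 * k.+1%:R^-1 * S < a.
  have e0 : 0 < a / (2 * S) by rewrite divr_gt0// mulr_gt0.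
  have [k] := ltr_add_invr e0; rewrite add0r => kP.
  exists k; move: kP; rewrite ltr_pdivlMr ?mulr_gt0//.
  by rewrite (_ : 2 * _ * S = k.+1%:R^-1 * (2 * S))//; ring.
have [e eE] : exists e : R, e = k.+1%:R^-1 by exists (k.+1%:R^-1).
have e0 : 0 < e by rewrite eE invr_gt0.
rewrite -eE in kP.
have /choice [q qP] : forall i, exists q : rat, `|f i x - ratr q| < e.
  move=> i; have lt_e : f i x - e < f i x + e by rewrite ltrBlDr -addrA ltrDl addr_gt0.
  have [q] := rat_in_itvoo lt_e.
  rewrite in_itv /= => /andP[q1 q2]; exists q.
  by rewrite ltr_norml; apply/andP; split; lra.
pose j := ([ffun i => q i], k).
have bj : bad j.
  exists w => // y yq.
  have yf i : `|y i - f i x| <= 2 * e.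
    have := yq i; have := qP i; rewrite /j /= ffunE -eE => h1 h2.
    have -> : y i - f i x = (y i - ratr (q i)) - (f i x - ratr (q i)) by ring.
    by apply: le_trans (ler_normB _ _) _; lra.
  have : \sum_i w i * y i - \sum_i w i * f i x <= \sum_i `|w i| * (2 * e).
    rewrite -sumrB ler_sum// => i _; rewrite -mulrBr.
    apply: le_trans (ler_norm _) _; rewrite normrM ler_wpM2l//.
  rewrite -mulr_suml => h.
  have : (\sum_i `|w i|) * (2 * e) <= 2 * e * S.
    rewrite mulrC ler_wpM2l//; first by rewrite mulr_ge0// ltW.
    by rewrite /S lerDr.
  rewrite /a in kP; lra.
exists (pickle j) => //; rewrite /G pickleK asboolT//.
by move=> i; rewrite /= ffunE -eE.
Qed.

End almost_everywhere.

(** * Complex and matrix valued functions *)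

Section complex_measurability.
Context d (T : measurableType d) (R : realType).
Local Notation C := R[i].
Implicit Types f g : T -> C.

Lemma cmeasurable_cst (c : C) : cmeasurable_fun setT (fun _ : T => c).
Proof. by split; exact: measurable_cst. Qed.

Lemma cmeasurableD f g : cmeasurable_fun setT f -> cmeasurable_fun setT g ->
  cmeasurable_fun setT (fun x => f x + g x).
Proof.
move=> [f1 f2] [g1 g2]; split.
  rewrite (_ : (fun x => _) = (fun x => complex.Re (f x)) \+ (fun x => complex.Re (g x))).
    exact: measurable_funD.
  by apply/funext => x; exact: raddfD.
rewrite (_ : (fun x => _) = (fun x => complex.Im (f x)) \+ (fun x => complex.Im (g x))).
  exact: measurable_funD.
by apply/funext => x; exact: raddfD.
Qed.

Lemma cmeasurableM f g : cmeasurable_fun setT f -> cmeasurable_fun setT g ->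
  cmeasurable_fun setT (fun x => f x * g x).
Proof.
move=> [f1 f2] [g1 g2]; split.
  rewrite (_ : (fun x => _) = (fun x => complex.Re (f x) * complex.Re (g x)) \-
                              (fun x => complex.Im (f x) * complex.Im (g x))).
    by apply: measurable_funB; exact: measurable_funM.
  by apply/funext => x; exact: cReM.
rewrite (_ : (fun x => _) = (fun x => complex.Re (f x) * complex.Im (g x)) \+
                            (fun x => complex.Im (f x) * complex.Re (g x))).
  by apply: measurable_funD; exact: measurable_funM.
by apply/funext => x; exact: cImM.
Qed.

Lemma cmeasurable_sum (I : finType) (f : I -> T -> C) :
  (forall i, cmeasurable_fun setT (f i)) ->
  cmeasurable_fun setT (fun x => \sum_i f i x).
Proof.
move=> mf; elim: (index_enum I) => [|i s IHs].
  rewrite (_ : (fun x => _) = fun=> 0); first exact: cmeasurable_cst.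
  by apply/funext => x; rewrite big_nil.
rewrite (_ : (fun x => _) = fun x => f i x + \sum_(i <- s) f i x).
  exact: cmeasurableD.
by apply/funext => x; rewrite big_cons.
Qed.

Lemma cmeasurable_real (u : T -> R) : measurable_fun setT u ->
  cmeasurable_fun setT (fun x => (u x)%:C).
Proof. by move=> mu; split => //; exact: measurable_cst. Qed.

Lemma cmeasurable_cvg (h : nat -> T -> C) f :
  (forall k, cmeasurable_fun setT (h k)) ->
  (forall x, complex.Re (h k x) @[k --> \oo] --> complex.Re (f x)) ->
  (forall x, complex.Im (h k x) @[k --> \oo] --> complex.Im (f x)) ->
  cmeasurable_fun setT f.
Proof.
move=> mh hRe hIm; split.
  by apply: (@measurable_fun_cvg _ _ _ _ (fun k x => complex.Re (h k x))) => [k|x _//];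
     exact: (mh k).1.
by apply: (@measurable_fun_cvg _ _ _ _ (fun k x => complex.Im (h k x))) => [k|x _//];
     exact: (mh k).2.
Qed.

Definition mxmeasurable {m n} (a : T -> 'M[C]_(m, n)) :=
  forall i j, cmeasurable_fun setT (fun x => a x i j).

Lemma eq_cmeasurable f g : f =1 g -> cmeasurable_fun setT f -> cmeasurable_fun setT g.
Proof. by move=> /funext ->. Qed.

Lemma mxmeasurable_cst m n (a : 'M[C]_(m, n)) : mxmeasurable (fun=> a).
Proof. by move=> i j; exact: cmeasurable_cst. Qed.

Lemma mxmeasurableD m n (a b : T -> 'M[C]_(m, n)) :
  mxmeasurable a -> mxmeasurable b -> mxmeasurable (fun x => a x + b x).
Proof.
move=> ma mb i j; apply: eq_cmeasurable (cmeasurableD (ma i j) (mb i j)) => x.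
by rewrite mxE.
Qed.

Lemma mxmeasurableM m n p (a : T -> 'M[C]_(m, n)) (b : T -> 'M[C]_(n, p)) :
  mxmeasurable a -> mxmeasurable b -> mxmeasurable (fun x => a x *m b x).
Proof.
move=> ma mb i j.
apply: eq_cmeasurable (cmeasurable_sum (fun k => cmeasurableM (ma i k) (mb k j))) => x.
by rewrite mxE.
Qed.

Lemma mxmeasurableZ m n f (a : T -> 'M[C]_(m, n)) :
  cmeasurable_fun setT f -> mxmeasurable a -> mxmeasurable (fun x => f x *: a x).
Proof.
move=> mf ma i j; apply: eq_cmeasurable (cmeasurableM mf (ma i j)) => x.
by rewrite mxE.
Qed.

Lemma mxmeasurable_tr n (a : T -> 'M[C]_n) : mxmeasurable a ->
  cmeasurable_fun setT (fun x => \tr (a x)).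
Proof. by move=> ma; apply: cmeasurable_sum => i; exact: ma. Qed.

Lemma mxmeasurable_qform n (a : T -> 'M[C]_n) v : mxmeasurable a ->
  cmeasurable_fun setT (fun x => qform (a x) v).
Proof.
move=> ma; have mv := mxmeasurableM (@mxmeasurable_cst _ _ (v^t*)) ma.
have := mxmeasurableM mv (@mxmeasurable_cst _ _ v).
exact.
Qed.

Lemma polar_mxmeasurable n (a : T -> 'M[C]_n) :
  (forall v, cmeasurable_fun setT (fun x => qform (a x) v)) -> mxmeasurable a.
Proof.
move=> ma i j; apply: (@eq_cmeasurable (fun x => polar (qform (a x)) i j)).
  by move=> x; rewrite -polarization.
have mc (c : C) f : cmeasurable_fun setT f -> cmeasurable_fun setT (fun x => c * f x).
  by apply: cmeasurableM; exact: cmeasurable_cst.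
have mN f : cmeasurable_fun setT f -> cmeasurable_fun setT (fun x => - f x).
  by move=> mf; apply: (eq_cmeasurable _ (mc (-1) _ mf)) => x; rewrite mulN1r.
apply: cmeasurableD; last by apply: (mN _); apply: (mc _); apply: cmeasurableD; exact: ma.
by apply: (mc _); apply: cmeasurableD; [|apply: (mN _); apply: (mc _)]; exact: ma.
Qed.

End complex_measurability.

Section states.
Context {R : realType} {n : nat}.
Local Notation C := R[i].
Hypothesis n_gt0 : (0 < n)%N.

Lemma qform1_eq0 (v : 'cV[C]_n) : qform 1%:M v = 0 -> v = 0.
Proof.
rewrite /qform mulmx1 mxE => /eqP; rewrite psumr_eq0 => [|i _]; last first.
  by rewrite !mxE mulrC mul_conjC_ge0.
move=> /allP v0; apply/colP => i; apply/eqP.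
by have := v0 i (mem_index_enum _); rewrite !mxE mulrC mul_conjC_eq0.
Qed.

Lemma vector_state (v : 'cV[C]_n) : v != 0 ->
  is_state ((qform 1%:M v)^-1 *: (v *m v^t*)).
Proof.
move=> v0; have q0 : qform 1%:M v != 0 by apply: contra v0 => /eqP/qform1_eq0/eqP.
split; last by rewrite mxtraceZ -[v *m _]mulmx1 -qform_tr mulVf.
apply: psdmxZ; first by rewrite invr_ge0 qform1_ge0.
by rewrite -{1}[v]adjmxK; exact: psdmx_gram.
Qed.

(** By polarization, states therefore determine matrices, as well as the measurability and
    integrability of matrix valued functions. *)
Lemma qform_state (v : 'cV[C]_n) : exists c (rho : 'M[C]_n), is_state rho /\
  forall a, qform a v = c * \tr (rho *m a).
Proof.
have [->|v0] := eqVneq v 0.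
  pose i : 'I_n := Ordinal n_gt0.
  have e0 : delta_mx i 0 != 0 :> 'cV[C]_n.
    by apply/eqP => /matrixP/(_ i 0)/eqP; rewrite !mxE !eqxx oner_eq0.
  have srho := vector_state e0; exists 0; eexists; split; first exact: srho.
  by move=> a; rewrite mul0r /qform mulmx0 mxE.
exists (qform 1%:M v), ((qform 1%:M v)^-1 *: (v *m v^t*)).
split; first exact: vector_state.
move=> a; rewrite -scalemxAl mxtraceZ -qform_tr mulrA mulfV ?mul1r//.
by apply: contra v0 => /eqP/qform1_eq0/eqP.
Qed.

Lemma state_ext (a b : 'M[C]_n) :
  (forall rho, is_state rho -> \tr (rho *m a) = \tr (rho *m b)) -> a = b.
Proof.
move=> ab; apply: qform_inj => v; have [c [rho [srho rhoE]]] := qform_state v.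
by rewrite !rhoE ab.
Qed.

Lemma qmeasurableP d (T : measurableType d) (a : T -> 'M[C]_n) :
  qmeasurable a <-> mxmeasurable a.
Proof.
split=> [ma|ma rho _].
  apply: polar_mxmeasurable => v; have [c [rho [srho rhoE]]] := qform_state v.
  apply: (eq_cmeasurable _ (cmeasurableM (@cmeasurable_cst _ T R c) (ma _ srho))) => x.
  by rewrite rhoE.
by apply: mxmeasurable_tr; apply: mxmeasurableM ma; exact: mxmeasurable_cst.
Qed.

End states.

Section complex_integrals.
Context d (T : measurableType d) (R : realType).
Variable mu : {measure set T -> \bar R}.
Local Notation C := R[i].
Implicit Types f g : T -> C.

Lemma eq_cintegrable E f g : f =1 g -> cintegrable mu E f -> cintegrable mu E g.
Proof. by move=> /funext ->. Qed.

Lemma cintegrableD f g : cintegrable mu setT f -> cintegrable mu setT g ->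
  cintegrable mu setT (fun x => f x + g x).
Proof.
move=> [f1 f2] [g1 g2]; split.
  apply: eq_integrable (integrableD measurableT f1 g1) => // x _.
  by rewrite /= -EFinD; congr EFin; apply/esym; exact: raddfD.
apply: eq_integrable (integrableD measurableT f2 g2) => // x _.
by rewrite /= -EFinD; congr EFin; apply/esym; exact: raddfD.
Qed.

Lemma cintegrableZ (c : C) f : cintegrable mu setT f ->
  cintegrable mu setT (fun x => c * f x).
Proof.
move=> [f1 f2]; split.
  apply: eq_integrable (integrableB measurableT
    (integrableZl measurableT (complex.Re c) f1)
    (integrableZl measurableT (complex.Im c) f2)) => // x _.
  by rewrite /= -!EFinM -EFinB; congr EFin; rewrite -cReM.
apply: eq_integrable (integrableD measurableT
    (integrableZl measurableT (complex.Re c) f2)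
    (integrableZl measurableT (complex.Im c) f1)) => // x _.
by rewrite /= -!EFinM -EFinD; congr EFin; rewrite -cImM.
Qed.

Lemma polar_cintegrable n (a : T -> 'M[C]_n) :
  (forall v, cintegrable mu setT (fun x => qform (a x) v)) ->
  forall i j, cintegrable mu setT (fun x => a x i j).
Proof.
move=> ma i j; apply: (@eq_cintegrable _ (fun x => polar (qform (a x)) i j)).
  by move=> x; rewrite -polarization.
have mN f : cintegrable mu setT f -> cintegrable mu setT (fun x => - f x).
  by move=> mf; apply: (eq_cintegrable _ (cintegrableZ (-1) mf)) => x; rewrite mulN1r.
apply: cintegrableD; last by apply: (mN _); apply: cintegrableZ; apply: cintegrableD; exact: ma.
by apply: cintegrableZ; apply: cintegrableD; [|apply: (mN _); apply: cintegrableZ]; exact: ma.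
Qed.

Definition mxintegral {m n} (E : set T) (a : T -> 'M[C]_(m, n)) : 'M[C]_(m, n) :=
  \matrix_(i, j) cintegral mu E (fun x => a x i j).

(* [weight A] and [coord z] are the real coordinates in which the real part of the
   trace of [A *m z] becomes a scalar product. *)
Let coord {m n} (z : 'M[C]_(m, n)) (k : ('I_m * 'I_n) * bool) : R :=
  if k.2 then complex.Re (z k.1.1 k.1.2) else complex.Im (z k.1.1 k.1.2).

Let weight {m n} (A : 'M[C]_(n, m)) (k : ('I_m * 'I_n) * bool) : R :=
  if k.2 then complex.Re (A k.1.2 k.1.1) else - complex.Im (A k.1.2 k.1.1).

Let Re_trE m n (A : 'M[C]_(n, m)) (z : 'M[C]_(m, n)) :
  complex.Re (\tr (A *m z)) = \sum_k weight A k * coord z k.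
Proof.
rewrite Re_tr_mulE pair_bigA /= -(pair_bigA _ (fun i b => weight A (i, b) * coord z (i, b))) /=.
apply: eq_bigr => -[i j] _; rewrite big_bool /weight /coord /=.
by rewrite mulNr.
Qed.

Let coord_int m n (a : T -> 'M[C]_(m, n)) k :
  (forall i j, cintegrable mu setT (fun x => a x i j)) ->
  mu.-integrable setT (EFin \o (fun x => coord (a x) k)).
Proof. by case: k => -[i j] [] ia; rewrite /coord /=; have [] := ia i j. Qed.

Let coord_mxint m n E (a : T -> 'M[C]_(m, n)) k :
  coord (mxintegral E a) k = \int[mu]_(x in E) coord (a x) k.
Proof. by case: k => -[i j] []; rewrite /coord /mxintegral /= mxE. Qed.

Lemma Re_tr_mxintegral m n (A : 'M[C]_(n, m)) (a : T -> 'M[C]_(m, n)) E :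
  measurable E -> (forall i j, cintegrable mu setT (fun x => a x i j)) ->
  complex.Re (\tr (A *m mxintegral E a)) = \int[mu]_(x in E) complex.Re (\tr (A *m a x)).
Proof.
move=> mE ia; have [_ e] := Rintegral_sum (weight A) mE (fun k => coord_int k ia).
rewrite Re_trE; under eq_bigr do rewrite coord_mxint.
by rewrite -e; apply: eq_Rintegral => x _; rewrite Re_trE.
Qed.

Lemma Im_tr_mxintegral m n (A : 'M[C]_(n, m)) (a : T -> 'M[C]_(m, n)) E :
  measurable E -> (forall i j, cintegrable mu setT (fun x => a x i j)) ->
  complex.Im (\tr (A *m mxintegral E a)) = \int[mu]_(x in E) complex.Im (\tr (A *m a x)).
Proof.
move=> mE ia.
have ImE (z : 'M[C]_(m, n)) :
    complex.Im (\tr (A *m z)) = complex.Re (\tr ((- 'i%C *: A) *m z)).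
  rewrite -scalemxAl mxtraceZ cReM; case: (\tr _) => x y /=.
  by rewrite oppr0 mul0r sub0r mulN1r opprK.
by rewrite ImE Re_tr_mxintegral//; apply: eq_Rintegral => x _; rewrite ImE.
Qed.

Lemma tr_mxintegral m n (A : 'M[C]_(n, m)) (a : T -> 'M[C]_(m, n)) E :
  measurable E -> (forall i j, cintegrable mu setT (fun x => a x i j)) ->
  \tr (A *m mxintegral E a) = cintegral mu E (fun x => \tr (A *m a x)).
Proof.
move=> mE ia; rewrite /cintegral -Re_tr_mxintegral// -Im_tr_mxintegral//.
by case: (\tr _).
Qed.

Lemma mx_ae_dual_nonneg m n (a : T -> 'M[C]_(m, n)) (D : set 'M[C]_(n, m)) :
  (forall i j, cintegrable mu setT (fun x => a x i j)) ->
  (forall A E, D A -> measurable E -> 0 <= complex.Re (\tr (A *m mxintegral E a))) ->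
  exists N, [/\ measurable N, mu N = 0%E &
    forall x, ~ N x -> forall A, D A -> 0 <= complex.Re (\tr (A *m a x))].
Proof.
move=> ia Da.
have [|w E [A DA <-] mE|N [mN N0 NP]] := @ae_dual_nonneg _ _ _ mu _ (fun k x => coord (a x) k)
    [set weight A | A in D].
- by move=> k; exact: coord_int.
- have := Da A E DA mE; rewrite Re_trE.
  by under eq_bigr do rewrite coord_mxint.
exists N; split => // x nNx A DA; rewrite Re_trE.
by apply: NP => //; exists A.
Qed.

End complex_integrals.

(** * Measurability of the functional calculus *)

Section sign_iteration.
Context {R : realType}.

(** The Newton-Schulz iteration for the sign. *)
Definition signstep (t : R) : R := (3 * t - t * t * t) / 2.

Lemma iter_signstepN k (t : R) : iter k signstep (- t) = - iter k signstep t.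
Proof. by elim: k => //= k ->; rewrite /signstep; field. Qed.

(** The identity [1 - signstep u = (1 - u)^2 (2 + u) / 2] gives a geometric rate, because
    the iterates stay above [t]. *)
Lemma iter_signstep_bound k (t : R) : 0 < t <= 1 ->
  t <= iter k signstep t <= 1 /\ 1 - iter k signstep t <= (1 - t / 2) ^+ k.
Proof.
move=> /andP[t0 t1]; elim: k => [|k [/andP[]]].
  by rewrite /= lexx t1 expr0; split => //; lra.
rewrite iterS exprS; move: (iter k signstep t) => u tu u1 IH.
have e : 1 - signstep u = (1 - u) * (1 - u) * (2 + u) / 2 by rewrite /signstep; field.
have u0 : 0 < u by exact: lt_le_trans tu.
have g : signstep u - u = u * (1 - u) * (1 + u) / 2 by rewrite /signstep; field.
split.
  apply/andP; split.
    apply: le_trans tu _; rewrite -subr_ge0 g !mulr_ge0 ?invr_ge0//; lra.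
  by rewrite -subr_ge0 e !mulr_ge0 ?invr_ge0//; lra.
rewrite e; apply: le_trans (_ : (1 - t / 2) * (1 - u) <= _); last first.
  by rewrite ler_wpM2l//; lra.
nra.
Qed.

Lemma cvg_signstep (t : R) : -1 <= t <= 1 ->
  iter k signstep t @[k --> \oo] --> Num.sg t.
Proof.
have pos (u : R) : 0 < u <= 1 -> iter k signstep u @[k --> \oo] --> (1 : R).
  move=> u01; have /andP[u0 u1] := u01.
  have : (fun k => (1 : R) - (1 - u / 2) ^+ k) @ \oo --> (1 - 0 : R).
    apply: cvgB; first exact: cvg_cst.
    by apply: cvg_expr; rewrite ger0_norm; lra.
  rewrite subr0 => h.
  apply: (@squeeze_cvgr _ _ _ _ (fun k => 1 - (1 - u / 2) ^+ k) (fun=> 1));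
    [|exact: h|exact: cvg_cst].
  apply: nearW => k; have [/andP[_ ->] h2] := iter_signstep_bound k u01.
  by rewrite andbT lerBlDr -lerBlDl.
move=> /andP[tN1 t1]; have [t0|t0|->] := ltgtP t 0.
- rewrite ltr0_sg//.
  have := pos (- t); rewrite oppr_gt0 t0 lerNl => /(_ tN1) h.
  rewrite (_ : (fun k => _) = (fun k => - iter k signstep (- t))); first exact: cvgN h.
  by apply/funext => k; rewrite iter_signstepN opprK.
- by rewrite gtr0_sg//; apply: pos; rewrite t0.
- rewrite sgr0; apply: cvg_near_cst; apply: nearW => k.
  by elim: k => //= k ->; rewrite /signstep; field.
Qed.

End sign_iteration.

Section measurable_calculus.
Import HBSimple HBNNSimple.
Context d (T : measurableType d) (R : realType) (n : nat).
Local Notation C := R[i].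

Lemma cvg_mxfun (f : R -> R) (h : nat -> R -> R) (a : 'M[C]_n) i j :
  (forall l, h k (specval a l) @[k --> \oo] --> f (specval a l)) ->
  complex.Re (mxfun (h k) a i j) @[k --> \oo] --> complex.Re (mxfun f a i j) /\
  complex.Im (mxfun (h k) a i j) @[k --> \oo] --> complex.Im (mxfun f a i j).
Proof.
move=> hf.
have key (c : 'I_n -> R) :
    \sum_l c l * h k (specval a l) @[k --> \oo] --> \sum_l c l * f (specval a l).
  elim: (index_enum 'I_n) => [|l s IHs].
    rewrite big_nil; apply: cvg_near_cst; apply: nearW => k; exact: big_nil.
  rewrite big_cons; under eq_fun do rewrite big_cons.
  by apply: cvgD => //; apply: cvgMl_tmp; exact: hf.
pose c l := Num.conj (spectralmx a l i) * spectralmx a l j.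
have ReE g : complex.Re (mxfun g a i j) = \sum_l complex.Re (c l) * g (specval a l).
  rewrite mxfun_coefE raddf_sum /=; apply: eq_bigr => l _.
  by rewrite -/(c l); case: (c l) => x y /=; rewrite mulr0 subr0.
have ImE g : complex.Im (mxfun g a i j) = \sum_l complex.Im (c l) * g (specval a l).
  rewrite mxfun_coefE raddf_sum /=; apply: eq_bigr => l _.
  by rewrite -/(c l); case: (c l) => x y /=; rewrite mulr0 add0r.
split; [under eq_fun do rewrite ReE; rewrite ReE|under eq_fun do rewrite ImE; rewrite ImE];
  exact: key.
Qed.

Definition calculus_measurable (f : R -> R) := forall a : T -> 'M[C]_n,
  (forall x, a x \is hermsymmx) -> mxmeasurable a ->
  mxmeasurable (fun x => mxfun f (a x)).

Let eq_mxmeasurable (a b : T -> 'M[C]_n) : a =1 b -> mxmeasurable a -> mxmeasurable b.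
Proof. by move=> /funext ->. Qed.

Lemma calculus_measurable_cvg (f : R -> R) (h : nat -> R -> R) :
  (forall k, calculus_measurable (h k)) ->
  (forall t, h k t @[k --> \oo] --> f t) -> calculus_measurable f.
Proof.
move=> mh hf a ha ma i j.
have cv x := cvg_mxfun i j (fun l => hf (specval (a x) l)).
apply: (@cmeasurable_cvg _ _ _ (fun k x => mxfun (h k) (a x) i j)) => [k|x|x].
- exact: mh.
- by have [] := cv x.
- by have [] := cv x.
Qed.

Lemma calculus_measurable_cst c : calculus_measurable (fun=> c).
Proof.
move=> a _ _; apply: (@eq_mxmeasurable (fun=> c%:C *: 1%:M)).
  by move=> x; rewrite mxfun_cst.
exact: mxmeasurable_cst.
Qed.

Lemma calculus_measurable_id : calculus_measurable id.
Proof. by move=> a ha; apply: eq_mxmeasurable => x; rewrite mxfun_id. Qed.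

Lemma calculus_measurableD f g : calculus_measurable f -> calculus_measurable g ->
  calculus_measurable (fun t => f t + g t).
Proof.
move=> mf mg a ha ma; apply: eq_mxmeasurable (mxmeasurableD (mf a ha ma) (mg a ha ma)).
by move=> x; rewrite mxfunD.
Qed.

Lemma calculus_measurableM f g : calculus_measurable f -> calculus_measurable g ->
  calculus_measurable (fun t => f t * g t).
Proof.
move=> mf mg a ha ma; apply: eq_mxmeasurable (mxmeasurableM (mf a ha ma) (mg a ha ma)).
by move=> x; rewrite mxfunM.
Qed.

Lemma calculus_measurableZ c f : calculus_measurable f ->
  calculus_measurable (fun t => c * f t).
Proof. by move=> mf; apply: calculus_measurableM mf; exact: calculus_measurable_cst. Qed.

Lemma calculus_measurable_comp f g : calculus_measurable f -> calculus_measurable g ->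
  calculus_measurable (f \o g).
Proof.
move=> mf mg a ha ma; apply: (@eq_mxmeasurable (fun x => mxfun f (mxfun g (a x)))).
  by move=> x; rewrite mxfun_comp.
by apply: mf; [move=> x; exact: mxfun_herm|exact: mg].
Qed.

Lemma calculus_measurable_signstep k : calculus_measurable (iter k signstep).
Proof.
have mid := calculus_measurable_id.
have mstep : calculus_measurable signstep.
  have -> : signstep = (fun t : R => 2^-1 * (3 * t + -1 * (t * (t * t)))).
    by apply/funext => t; rewrite /signstep; field.
  apply/calculus_measurableZ/calculus_measurableD; apply: calculus_measurableZ.
    exact: mid.
  exact: calculus_measurableM mid (calculus_measurableM mid mid).
elim: k => [|k IHk]; first exact: mid.
rewrite (_ : iter k.+1 signstep = signstep \o iter k signstep).
  exact: calculus_measurable_comp mstep IHk.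
exact/funext.
Qed.

(** The iteration converges to the sign on [-1, 1] only, hence the scalar normalization
    of [a x], by a positive function which leaves the signs of the eigenvalues unchanged. *)
Lemma calculus_measurable_sg : calculus_measurable Num.sg.
Proof.
move=> a ha ma.
pose q x : R := complex.Re (\tr (a x *m a x)).
have qE x : q x = \sum_i specval (a x) i ^+ 2.
  rewrite /q -{1 2}(mxfun_id (ha x)) -mxfunM tr_mxfun /=.
  by apply: eq_bigr => i _; rewrite expr2.
have q0 x : 0 <= q x by rewrite qE sumr_ge0// => i _; exact: sqr_ge0.
(* [q x] bounds the square of every eigenvalue of [a x], and [1 + q x <= expR (q x)]. *)
pose c x := expR (- q x).
have mq : measurable_fun setT q by have [] := mxmeasurable_tr (mxmeasurableM ma ma).
have mc : measurable_fun setT c.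
  by apply: measurableT_comp => //; exact: measurable_funN.
have c0 x : 0 < c x by exact: expR_gt0.
have cb x i : -1 <= c x * specval (a x) i <= 1.
  rewrite -ler_norml normrM gtr0_norm//.
  have e1 : 1 + q x <= expR (q x) by exact: expR_ge1Dx.
  have e2 : c x * expR (q x) = 1 by rewrite /c mulrC expRxMexpNx_1.
  have e3 : `|specval (a x) i| <= 1 + q x.
    have : `|specval (a x) i| ^+ 2 <= q x.
      rewrite real_normK ?num_real// qE (bigD1 i)//= lerDl sumr_ge0// => k _; exact: sqr_ge0.
    have := sqr_ge0 (`|specval (a x) i| - 1); rewrite sqrrB1; nra.
  rewrite -e2 ler_pM2l//; exact: le_trans e3 e1.
have mb : mxmeasurable (fun x => (c x)%:C *: a x).
  by apply: mxmeasurableZ ma; exact: cmeasurable_real.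
have hb x : (c x)%:C *: a x \is hermsymmx by exact: hermmxZ.
have bE f x : mxfun f ((c x)%:C *: a x) = mxfun (fun t => f (c x * t)) (a x).
  by rewrite -[a x in LHS](mxfun_id (ha x)) -(mxfunZ _ id) mxfun_comp.
have sgE x : mxfun Num.sg (a x) = mxfun (fun t => Num.sg (c x * t)) (a x).
  by apply: eq_mxfun => i; rewrite sgrM (gtr0_sg (c0 x)) mul1r.
move=> i j.
have cv x := @cvg_mxfun (fun t => Num.sg (c x * t))
  (fun k t => iter k signstep (c x * t)) (a x) i j
  (fun l => cvg_signstep (cb x l)).
apply: (@cmeasurable_cvg _ _ _
  (fun k x => mxfun (iter k signstep) ((c x)%:C *: a x) i j)) => [k|x|x].
- exact: calculus_measurable_signstep.
- by rewrite sgE; under eq_fun do rewrite bE; have [] := cv x.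
- by rewrite sgE; under eq_fun do rewrite bE; have [] := cv x.
Qed.

Lemma calculus_measurable_ray (r : R) : calculus_measurable \1_(`]r, +oo[%classic : set R).
Proof.
have -> : \1_(`]r, +oo[%classic : set R) =
    (fun t : R => 2^-1 * (Num.sg t * Num.sg t + Num.sg t)) \o (fun t : R => t + - r).
  apply/funext => t /=; rewrite indicE.
  have [rt|tr|->] := ltgtP r t.
  - by rewrite mem_set/= ?in_itv/= ?rt// gtr0_sg ?subr_gt0//; field.
  - by rewrite memNset/= ?in_itv/= ?andbT ?ltNge ?ltW// ltr0_sg ?subr_lt0//; field.
  - by rewrite memNset/= ?in_itv/= ?andbT ?ltxx// subrr sgr0; field.
apply: calculus_measurable_comp; last first.
  exact: calculus_measurableD calculus_measurable_id (calculus_measurable_cst _).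
have msg := calculus_measurable_sg.
exact: calculus_measurableZ (calculus_measurableD (calculus_measurableM msg msg) msg).
Qed.

(** Rays come from the sign function, and the sets with this property form a
    sigma-algebra. *)
Lemma calculus_measurable_indic (B : set R) : measurable B -> calculus_measurable \1_B.
Proof.
rewrite [measurable]RGenOInfty.measurableE => mB.
suff sub : <<s @RGenOInfty.G R >> `<=` [set A | calculus_measurable \1_A] by exact: sub mB.
apply: smallest_sub; last by move=> _ [r ->]; exact: calculus_measurable_ray.
have mU (A A' : set R) : calculus_measurable \1_A -> calculus_measurable \1_A' ->
    calculus_measurable \1_(A `|` A').
  move=> mA mA'; have -> : \1_(A `|` A') =
      (fun t : R => (\1_A t + \1_A' t) + -1 * (\1_A t * \1_A' t)) :> (R -> R).
apply/funext => t; rewrite !indicE in_setU; case: (t \in A); case: (t \in A') => /=; ring.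
  have h1 := calculus_measurableD mA mA'.
  have h2 := calculus_measurableZ (-1) (calculus_measurableM mA mA').
  exact: (calculus_measurableD h1 h2).
split.
- by rewrite /= indic0; exact: calculus_measurable_cst.
- move=> A mA; rewrite /=; have -> : \1_(setT `\` A) = (fun t : R => 1 + -1 * \1_A t) :> (R -> R).
    apply/funext => t; rewrite setTD !indicE in_setC; case: (t \in A) => /=; ring.
  exact: (calculus_measurableD (calculus_measurable_cst 1) (calculus_measurableZ (-1) mA)).
- move=> F mF; rewrite /=.
  apply: (@calculus_measurable_cvg _ (fun k => \1_(\big[setU/set0]_(i < k) F i))).
    elim=> [|k IHk]; first by rewrite big_ord0 indic0; exact: calculus_measurable_cst.
    rewrite big_ord_recr /=; exact: (mU _ _ IHk (mF k)).
  move=> t; apply: cvg_near_cst; have [[k _ Fkt]|nFt] := pselect ((\bigcup_k F k) t).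
    exists k.+1 => // m /= km; rewrite !indicE !mem_set//; first by exists k.
    by rewrite -bigcup_mkord; exists k.
  apply: nearW => k; rewrite !indicE !memNset// -bigcup_mkord => -[m _ Fmt].
  by apply: nFt; exists m.
Qed.

Lemma calculus_measurable_ge0 (f : R -> R) : (forall t, 0 <= f t) ->
  measurable_fun setT f -> calculus_measurable f.
Proof.
move=> f0 mf; have mf' : measurable_fun setT (EFin \o f) by exact/measurable_EFinP.
pose h k : R -> R := nnsfun_approx measurableT mf' k.
have hf t : h k t @[k --> \oo] --> f t.
  have := cvg_nnsfun_approx measurableT mf' (fun x _ => f0 x) (I : setT t).
  by move/fine_cvgP => [].
suff mh k : calculus_measurable (h k) by exact: (calculus_measurable_cvg mh hf).
rewrite /h; set g := nnsfun_approx _ _ _.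
rewrite (_ : (g : R -> R) = fun t =>
  \sum_(y <- finmap.enum_fset (fset_set (range g))) y * \1_(g @^-1` [set y]) t).
  elim: (finmap.enum_fset _) => [|y s IHs].
    by under eq_fun do rewrite big_nil; exact: calculus_measurable_cst.
  under eq_fun do rewrite big_cons.
  apply: calculus_measurableD IHs; apply/calculus_measurableZ/calculus_measurable_indic.
  by exact: measurable_funPTI.
by apply/funext => t; rewrite fimfunE fsbig_finite//; exact: fimfunP.
Qed.

(** Polynomials preserve measurability and so do pointwise limits, as only finitely many
    eigenvalues matter at each point: the sign, indicators and simple functions follow
    in turn. *)
Lemma mxfun_measurable (f : R -> R) (a : T -> 'M[C]_n) : measurable_fun setT f ->
  (forall x, a x \is hermsymmx) -> mxmeasurable a ->
  mxmeasurable (fun x => mxfun f (a x)).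
Proof.
move=> mf; suff : calculus_measurable f by exact.
have -> : f = (fun t => Num.max (f t) 0 + -1 * Num.max (- f t) 0).
  apply/funext => t; have [f0|f0] := leP 0 (f t).
    by rewrite (max_idPr _) ?oppr_le0// mulr0 addr0.
  by rewrite (max_idPl _) ?oppr_ge0 ?ltW//; ring.
apply: calculus_measurableD; [|apply: calculus_measurableZ];
  (apply: calculus_measurable_ge0; first by move=> t; rewrite le_max lexx orbT).
  by apply: measurable_maxr => //; exact: measurable_cst.
by apply: measurable_maxr; [exact: measurable_funN|exact: measurable_cst].
Qed.

End measurable_calculus.

(** * The density of an operator valued measure *)

Section radon_nikodym.
Context d (T : measurableType d) (R : realType) (n : nat).
Variable nu : povm T R n.
Local Notation C := R[i].
Local Notation mu := (trace_measure nu).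

Lemma trace_measure_eq0 E : (0 < n)%N -> mu E = 0%E -> nu E = 0.
Proof.
move=> n0 [] /eqP; rewrite mulf_eq0 invr_eq0 pnatr_eq0 gtn_eqF//= => /eqP tr0.
exact: psd_tr0 (povm_psd nu E) tr0.
Qed.

Lemma povm0 : nu set0 = 0.
Proof.
have [n0|n_gt0] := posnP n; last by apply: trace_measure_eq0 => //; exact: measure0.
by apply/matrixP => i; have := ltn_ord i; rewrite [X in (_ < X)%N]n0.
Qed.

Lemma trace_measure_fin : fin_num_fun mu.
Proof. by []. Qed.

HB.instance Definition _ := @Measure_isFinite.Build _ T R mu trace_measure_fin.

Definition coordinate_charge (rho : 'M[C]_n) (E : set T) : \bar R :=
  (complex.Re (\tr (rho *m nu E)))%:E.

Variable rho : 'M[C]_n.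

Let coordinate_charge0 : coordinate_charge rho set0 = 0%E.
Proof. by rewrite /coordinate_charge povm0 mulmx0 mxtrace0. Qed.

Let coordinate_charge_fin E : measurable E -> coordinate_charge rho E \is a fin_num.
Proof. by []. Qed.

Let coordinate_charge_sigma_additive : semi_sigma_additive (coordinate_charge rho).
Proof.
move=> A mA tA _; rewrite /coordinate_charge.
rewrite (_ : (fun N => _) = EFin \o
    (fun N => complex.Re (\sum_(0 <= k < N) \tr (rho *m nu (A k))))); last first.
  by apply/funext => N /=; rewrite raddf_sum sumEFin.
apply: cvg_EFin; first exact: nearW.
have /cvgrPdist_lt ul := @povm_sigma_additive _ _ _ _ nu _ mA tA rho.
apply/cvgrPdist_lt => e e0.
have /ul : 0 < e%:C :> C by rewrite ltcR.
apply: filterS => N /= le; rewrite -ltcR; apply: le_lt_trans le.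
by rewrite -raddfB; exact: normc_ge_Re.
Qed.

HB.instance Definition _ := isCharge.Build _ T R (coordinate_charge rho)
  coordinate_charge0 coordinate_charge_fin coordinate_charge_sigma_additive.

Lemma coordinate_density : (0 < n)%N -> exists f : T -> R,
  mu.-integrable setT (EFin \o f) /\
  forall E, measurable E -> complex.Re (\tr (rho *m nu E)) = \int[mu]_(x in E) f x.
Proof.
move=> n0; have dom : coordinate_charge rho `<< mu.
  apply/null_content_dominatesP => A mA /(trace_measure_eq0 n0) A0.
  by rewrite /coordinate_charge A0 mulmx0 mxtrace0.
pose f := Radon_Nikodym (coordinate_charge rho) mu.
have ff x : f x \is a fin_num by exact: Radon_Nikodym_fin_num.
have fE : EFin \o (fine \o f) = f by apply/funext => x /=; rewrite fineK.
exists (fine \o f); rewrite fE; split; first exact: Radon_Nikodym_integrable.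
move=> E mE; rewrite /Rintegral.
rewrite (_ : (\int[mu]_(x in E) _)%E = (\int[mu]_(x in E) f x)%E).
  by rewrite -(Radon_Nikodym_integral dom mE).
by apply: eq_integral => x _; exact: fineK.
Qed.

End radon_nikodym.

Section povm_density.
Context d (T : measurableType d) (R : realType) (n : nat).
Variable nu : povm T R n.
Hypothesis n_gt0 : (0 < n)%N.
Local Notation C := R[i].
Local Notation mu := (trace_measure nu).

Lemma matrix_density : exists h : T -> 'M[C]_n,
  (forall i j, cintegrable mu setT (fun x => h x i j)) /\
  forall E, measurable E -> nu E = mxintegral mu E h.
Proof.
have /choice [f fP] : forall k : 'I_n * 'I_n, exists f : T -> C,
    cintegrable mu setT f /\
    forall E, measurable E -> nu E k.1 k.2 = cintegral mu E f.
  move=> [i j] /=.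
  have trE (c : C) E : \tr ((c *: delta_mx j i) *m nu E) = c * nu E i j.
    rewrite -scalemxAl mxtraceZ; congr (_ * _).
    rewrite -(@mul_delta_mx _ _ 1 _ 0 j i) -mulmxA mxtrace_mulC.
    by rewrite -rowE /mxtrace big_ord1 -colE !mxE.
  have [u [iu uE]] := @coordinate_density _ _ _ _ nu (1 *: delta_mx j i) n_gt0.
  have [v [iv vE]] := @coordinate_density _ _ _ _ nu (- 'i%C *: delta_mx j i) n_gt0.
  exists (fun x => u x +i* v x); split; first by [].
  move=> E mE; rewrite /cintegral /= -uE// -vE// !trE mul1r.
  by case: (nu E i j) => x y /=; rewrite oppr0 mul0r sub0r mulN1r opprK.
exists (fun x => \matrix_(i, j) f (i, j) x); split.
  move=> i j; apply: (eq_cintegrable _ (fP (i, j)).1) => x.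
  by rewrite mxE.
move=> E mE; apply/matrixP => i j; rewrite mxE (fP (i, j)).2//; congr cintegral.
by apply/funext => x; rewrite mxE.
Qed.

(** The entries have Radon-Nikodym densities. The matrix they form is positive almost
    everywhere because its integrals are, and it is replaced by 0 on the exceptional null
    set. *)
Lemma povm_derivP : is_povm_deriv nu (povm_deriv nu).
Proof.
apply: xgetPex; have [h [ih hE]] := matrix_density.
pose D := [set A : 'M[C]_n | exists v : 'cV[C]_n, exists2 kap : C,
  0 <= complex.Re kap & A = kap *: (v *m v^t*)].
have DE kap v (a : 'M[C]_n) : \tr (kap *: (v *m v^t*) *m a) = kap * qform a v.
  by rewrite -scalemxAl mxtraceZ -qform_tr.
have [|A E [v [kap kap0 ->]] mE|N [mN N0 NP]] := @mx_ae_dual_nonneg _ _ _ mu _ _ h D.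
- exact: ih.
- by rewrite -(hE _ mE) DE; exact: ((ge0_Re_mulP _).1 (povm_psd nu E v)).
have hpsd x : ~ N x -> psdmx (h x).
  move=> /NP hx v; apply/ge0_Re_mulP => kap kap0.
  by have := hx _ (ex_intro _ v (ex_intro2 _ _ kap kap0 erefl)); rewrite DE.
pose h' x := if x \in N then 0 else h x.
have aeE (phi : C -> R) i j :
    ae_eq mu setT (fun x => (phi (h' x i j))%:E) (fun x => (phi (h x i j))%:E).
  exists N; split => // x /= nh; apply: contrapT => nNx; apply: nh => _.
  by rewrite /h' memNset.
have mh i j : cmeasurable_fun setT (fun x => h x i j).
  have [h1 h2] := ih i j.
  by split; apply/measurable_EFinP; [exact: (measurable_int mu h1)|exact: (measurable_int mu h2)].
have mh' : mxmeasurable h'.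
  have -> : h' = fun x => ((1 - \1_N x)%:C *: h x).
    apply/funext => x; rewrite /h' indicE; case: (x \in N).
      by rewrite subrr scale0r.
    by rewrite subr0 scale1r.
  apply: mxmeasurableZ mh; apply: cmeasurable_real.
  by apply: measurable_funB; [exact: measurable_cst|exact: measurable_indic].
have ih' i j : cintegrable mu setT (fun x => h' x i j).
  have [h1 h2] := ih i j; have [m1 m2] := mh' i j.
  split; [apply: (le_integrable measurableT _ _ h1)|apply: (le_integrable measurableT _ _ h2)];
    try (by apply/measurable_EFinP);
    move=> x _ /=; rewrite lee_fin /h'; case: ifP => // _; by rewrite mxE normr0.
exists h'; split => //.
- move=> x; rewrite /h'; case: ifPn => [_|]; first exact: psdmx0.
  by move=> nN; apply: hpsd => Nx; move: nN; rewrite mem_set.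
- by apply/qmeasurableP.
- move=> E mE; rewrite hE//; apply/matrixP => i j; rewrite !mxE /cintegral.
  have mS (u : T -> R) : measurable_fun setT (EFin \o u) -> measurable_fun E (EFin \o u).
    by apply: measurable_funS.
  have [h1 h2] := ih i j; have [h1' h2'] := ih' i j.
  congr (_ +i* _); rewrite /Rintegral; congr fine; apply: ae_eq_integral => //;
    try (by apply/mS/measurable_int; eassumption).
    by apply: ae_eq_subset (ae_eq_sym (aeE (@complex.Re R) i j)).
  by apply: ae_eq_subset (ae_eq_sym (aeE (@complex.Im R) i j)).
Qed.

End povm_density.

(** * Quantum expectations as matrix integrals *)

Section expectation.
Context d (T : measurableType d) (R : realType) (n : nat).
Variable nu : povm T R n.
Hypothesis n_gt0 : (0 < n)%N.
Local Notation C := R[i].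
Local Notation mu := (trace_measure nu).
Local Notation h := (povm_deriv nu).
Implicit Types psi : T -> 'M[C]_n.

(** The matrix valued function whose traces against states are given by [qdensity]. *)
Definition weighted psi (x : T) : 'M[C]_n := sqrtmx (h x) *m psi x *m sqrtmx (h x).

Lemma povm_deriv_psd x : psdmx (h x).
Proof. by have [] := povm_derivP nu n_gt0. Qed.

Lemma povm_deriv_measurable : mxmeasurable h.
Proof. by have [_ /(qmeasurableP n_gt0)] := povm_derivP nu n_gt0. Qed.

Lemma sqrt_povm_deriv_measurable : mxmeasurable (fun x => sqrtmx (h x)).
Proof.
apply: mxfun_measurable.
- exact: (continuous_measurable_fun (@sqrt_continuous R)).
- by move=> x; exact: psdmx_herm (povm_deriv_psd x).
- exact: povm_deriv_measurable.
Qed.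

Lemma qintegrable_weighted psi : qintegrable nu psi ->
  forall i j, cintegrable mu setT (fun x => weighted psi x i j).
Proof.
move=> [_ ipsi]; apply: polar_cintegrable => v.
have [c [rho [srho rhoE]]] := qform_state n_gt0 v.
by apply: (eq_cintegrable _ (cintegrableZ c (ipsi rho srho))) => x; rewrite rhoE.
Qed.

Lemma cintegral_restrict E (f : T -> C) :
  cintegral mu setT (fun x => (\1_E x)%:C * f x) = cintegral mu E f.
Proof.
rewrite /cintegral; congr (_ +i* _); rewrite [RHS]Rintegral_mkcond;
  apply: eq_Rintegral => x _; rewrite /patch indicE; case: (x \in E); case: (f x) => a b /=;
  by rewrite ?mul0r ?mul1r ?subr0 ?addr0.
Qed.

Lemma qexpectation_restrict psi E :
  (forall i j, cintegrable mu setT (fun x => weighted psi x i j)) -> measurable E ->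
  qexpectation nu (qrestrict psi E) = mxintegral mu E (weighted psi).
Proof.
move=> ipsi mE.
have key rho : \tr (rho *m mxintegral mu E (weighted psi)) =
    cintegral mu setT (qdensity nu (qrestrict psi E) rho).
  rewrite (tr_mxintegral _ mE ipsi) -cintegral_restrict.
  congr (cintegral mu setT _); apply/funext => x; rewrite /qdensity /qrestrict /weighted.
  by rewrite -scalemxAr -scalemxAl -scalemxAr mxtraceZ.
rewrite /qexpectation; set P := [set a | _].
have : P (xget 0 P) by apply: xgetPex; exists (mxintegral mu E (weighted psi)).
by move=> xP; apply: (state_ext n_gt0) => rho srho; rewrite xP.
Qed.

Lemma cintegrable_qform (a : T -> 'M[C]_n) v :
  (forall i j, cintegrable mu setT (fun x => a x i j)) ->
  mu.-integrable setT (fun x => (complex.Re (qform (a x) v))%:E).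
Proof.
move=> ia; have isum m (f : 'I_m -> T -> C) : (forall i, cintegrable mu setT (f i)) ->
    cintegrable mu setT (fun x => \sum_i f i x).
  move=> jf; elim: (index_enum _) => [|i s IHs].
    apply: (@eq_cintegrable _ _ _ _ _ (fun=> 0)); first by move=> x; rewrite big_nil.
    by split; exact: integrable0.
  by apply: (eq_cintegrable _ (cintegrableD (jf i) IHs)) => x; rewrite big_cons.
have [] := isum n _ (fun i => isum n _ (fun j =>
  cintegrableZ ((v *m v^t*) i j) (ia j i))).
move=> + _; apply: eq_integrable => // x _; congr (complex.Re _)%:E.
by rewrite qform_tr; apply: eq_bigr => i _; rewrite [in RHS]mxE.
Qed.

(** The quadratic form of [weighted psi x] lies between those of [lo h x] and
    [hi h x]. *)
Lemma bounded_weighted_integrable psi (lo hi : R) : mxmeasurable psi ->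
  (forall x, selfadjoint_in `[lo, hi] (psi x)) ->
  forall i j, cintegrable mu setT (fun x => weighted psi x i j).
Proof.
move=> mpsi bpsi; have [_ _ ih _] := povm_derivP nu n_gt0.
have mw : mxmeasurable (weighted psi).
  by apply: mxmeasurableM sqrt_povm_deriv_measurable;
     exact: mxmeasurableM sqrt_povm_deriv_measurable mpsi.
have sa x : (sqrtmx (h x))^t* = sqrtmx (h x) by exact/hermmxP/sqrtmx_herm.
have wlo x v : 0 <= qform (weighted psi x) v - lo%:C * qform (h x) v.
  have [plo _] := spectrum_psd (bpsi x).
  have := psdmx_congr (sqrtmx (h x)) plo v; rewrite -/(qform _ v) sa.
  rewrite mulmxBr mulmxBl -scalemxAr -scalemxAl mulmx1.
  by rewrite (sqrtmxK (povm_deriv_psd x)) qformB qformZ.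
have whi x v : 0 <= hi%:C * qform (h x) v - qform (weighted psi x) v.
  have [_ phi] := spectrum_psd (bpsi x).
  have := psdmx_congr (sqrtmx (h x)) phi v; rewrite -/(qform _ v) sa.
  rewrite mulmxBr mulmxBl -scalemxAr -scalemxAl mulmx1.
  by rewrite (sqrtmxK (povm_deriv_psd x)) qformB qformZ.
have hq x v : 0 <= qform (h x) v by exact: povm_deriv_psd.
apply: polar_cintegrable => v.
have [m1 m2] := mxmeasurable_qform v mw.
have iB := integrableZl measurableT (`|lo| + `|hi|) (cintegrable_qform v ih).
split.
  apply: (le_integrable measurableT _ _ iB); first exact/measurable_EFinP.
  move=> x _; rewrite /= lee_fin.
  have := wlo x v; have := whi x v; have := hq x v.
  case: (qform (h x) v) => a b; case: (qform (weighted psi x) v) => a' b'.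
  rewrite !lecE /= !mul0r !subr0 => /andP[_ a0] /andP[_ h1] /andP[_ h2].
  rewrite normrM (ger0_norm a0) (ger0_norm (addr_ge0 (normr_ge0 _) (normr_ge0 _))).
  have := ler_norm hi; have := ler_norm (- lo); rewrite normrN => l1 l2.
  have := normr_ge0 hi; have := normr_ge0 lo => n1 n2.
  rewrite ler_norml; apply/andP; split; nra.
apply: (le_integrable measurableT _ _ iB); first exact/measurable_EFinP.
move=> x _; rewrite /= lee_fin.
have := wlo x v; have := hq x v.
case: (qform (h x) v) => a b; case: (qform (weighted psi x) v) => a' b'.
rewrite !lecE /= => /andP[/eqP -> a0] /andP[/eqP + _].
rewrite mulr0 mul0r addr0 subr0 => ->.
by rewrite normr0.
Qed.

End expectation.

Section triple_integral.
Context d (T : measurableType d) (R : realType) (n : nat).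
Variable mu : {measure set T -> \bar R}.
Local Notation C := R[i].

Lemma mxintegral_col m1 m2 (a : T -> 'M[C]_(m1, n)) (b : T -> 'M[C]_(m2, n)) E :
  mxintegral mu E (fun x => col_mx (a x) (b x)) =
  col_mx (mxintegral mu E a) (mxintegral mu E b).
Proof.
apply/matrixP => i j; rewrite mxE; case: (split_ordP i) => k ->;
  rewrite ?col_mxEu ?col_mxEd mxE; congr cintegral; apply/funext => x;
  by rewrite ?col_mxEu ?col_mxEd.
Qed.

Lemma cintegrable_col m1 m2 (a : T -> 'M[C]_(m1, n)) (b : T -> 'M[C]_(m2, n)) :
  (forall i j, cintegrable mu setT (fun x => a x i j)) ->
  (forall i j, cintegrable mu setT (fun x => b x i j)) ->
  forall i j, cintegrable mu setT (fun x => col_mx (a x) (b x) i j).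
Proof.
move=> ia ib i j; case: (split_ordP i) => k ->.
  by apply: (eq_cintegrable _ (ia k j)) => x; rewrite col_mxEu.
by apply: (eq_cintegrable _ (ib k j)) => x; rewrite col_mxEd.
Qed.

End triple_integral.

Section convex_measurable.
Context {R : realType}.

(** Sublevel sets of a convex function are intervals. *)
Lemma operator_convex_measurable (J : set R) (theta : R -> R) (a b : R) :
  operator_convex J theta -> `[a, b] `<=` J ->
  measurable_fun setT (theta \_ `[a, b]).
Proof.
move=> theta_convex abJ; apply/(measurable_restrictT _ (measurable_itv _)).
apply: (measurability (@RGenOInfty.G R)); first exact: RGenOInfty.measurableE.
move=> _ [_ [c ->] <-].
have -> : `[a, b] `&` theta @^-1` `]c, +oo[ =
    `[a, b] `\` [set t | `[a, b]%classic t /\ theta t <= c].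
  apply/seteqP; split => t /=; rewrite !in_itv /= andbT => -[tab].
    by move=> ct; split => // -[_]; rewrite leNgt ct.
  by move=> ntc; split => //; rewrite ltNge; apply/negP => tc; exact: ntc.
apply: measurableD; first exact: measurable_itv.
apply: is_interval_measurable => x y [xab xc] [yab yc] z xzy.
have zab : `[a, b]%classic z.
  move: xab yab xzy; rewrite /= !in_itv /= => /andP[ax _] /andP[_ yb] /andP[xz zy].
  by rewrite (le_trans ax xz) (le_trans zy yb).
by split => //; exact: (operator_convex_le theta_convex (abJ _ xab) (abJ _ yab) xzy).
Qed.

End convex_measurable.

(** * The conditional inequality *)

Section conditional_jensen.
Context d (T : measurableType d) (R : realType) (n : nat).
Variables (nu : povm T R n) (F : set (set T)) (FT : F `<=` measurable).
Hypotheses (n_gt0 : (0 < n)%N) (sigmaF : sigma_algebra setT F).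
Local Notation C := R[i].
Local Notation nuF := (povm_restr nu FT).
Local Notation mu := (trace_measure nu).
Local Notation muF := (trace_measure nuF).
Local Notation g := (povm_deriv nuF).
Implicit Types psi phi : T -> 'M[C]_n.

Lemma sub_measurableE (E : set (g_sigma_algebraType F)) : measurable E -> F E.
Proof. by move=> mE; rewrite -(sigma_algebra_id sigmaF). Qed.

Lemma measurable_subE (E : set (g_sigma_algebraType F)) : F E -> measurable E.
Proof. by move=> FE; rewrite -(sigma_algebra_id sigmaF) in FE. Qed.

Lemma condexp_mxintegral psi phi E :
  (forall i j, cintegrable mu setT (fun x => weighted nu psi x i j)) ->
  qcondexp_spec nu FT psi phi -> F E ->
  mxintegral muF E (weighted nuF phi) = mxintegral mu E (weighted nu psi).
Proof.
move=> ipsi [_ iphi eqE] FE; have iw := qintegrable_weighted n_gt0 iphi.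
rewrite -(qexpectation_restrict n_gt0 ipsi (FT FE)) (eqE _ FE).
by rewrite (qexpectation_restrict n_gt0 iw (measurable_subE FE)).
Qed.

(** Adding to [phi] the projection onto the kernel of the restricted density gives a
    function with the same characterising properties; by uniqueness this projection
    vanishes almost everywhere. *)
Lemma condexp_deriv_unit psi phi : is_qcondexp nu FT psi phi ->
  exists N, [/\ measurable N, nu N = 0 &
    forall x, ~ N x -> sqrtmx (g x) \in unitmx].
Proof.
move=> [[mphi iphi eqE] uniq_phi].
pose P x : 'M[C]_n := mxfun \1_[set 0 : R] (g x).
have sP x : sqrtmx (g x) *m P x = 0.
  rewrite /sqrtmx /P -mxfunM.
  transitivity (mxfun (fun=> 0) (g x)); last by rewrite mxfun_cst scale0r.
  apply: eq_mxfun => i; rewrite indicE; case: (boolP (_ \in _)) => [|_]; last by rewrite mulr0.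
  by rewrite inE /= => ->; rewrite sqrtr0 mul0r.
have qE E rho : qdensity nuF (qrestrict (fun x => phi x + P x) E) rho =
    qdensity nuF (qrestrict phi E) rho.
  apply/funext => x; rewrite /qdensity /qrestrict scalerDr mulmxDr -(scalemxAr _ _ (P x)).
  by rewrite sP scaler0 addr0.
have qdE rho : qdensity nuF (fun x => phi x + P x) rho = qdensity nuF phi rho.
  by apply/funext => x; rewrite /qdensity mulmxDr sP addr0.
have [|N [mN N0 sub]] := uniq_phi (fun x => phi x + P x).
  split.
  - apply/(qmeasurableP n_gt0)/mxmeasurableD; first exact/(qmeasurableP n_gt0).
    apply: mxfun_measurable; first exact: measurable_indic.
      by move=> x; exact: psdmx_herm (povm_deriv_psd nuF n_gt0 x).
    exact: povm_deriv_measurable.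
  - split; last by move=> rho srho; rewrite qdE; exact: iphi.2.
    apply/(qmeasurableP n_gt0)/mxmeasurableD; first exact/(qmeasurableP n_gt0).
    apply: mxfun_measurable; first exact: measurable_indic.
      by move=> x; exact: psdmx_herm (povm_deriv_psd nuF n_gt0 x).
    exact: povm_deriv_measurable.
  - by move=> E FE; rewrite (eqE E FE) /qexpectation (funext (qE E)).
exists N; split => // x nNx.
have Px : P x = 0.
  have : [set x | phi x + P x = phi x] x by apply: contrapT => /sub.
  by move=> /= /eqP; rewrite -subr_eq0 addrC addKr => /eqP.
have gpsd := povm_deriv_psd nuF n_gt0 x.
have gpos i : 0 < specval (g x) i.
  rewrite lt_def (specval_ge0 i gpsd) andbT; apply/eqP => gi0.
  have := tr_mxfun (\1_[set 0 : R]) (g x); rewrite -/(P x) Px mxtrace0 => -[] /esym/eqP.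
  rewrite psumr_eq0 => [/allP/(_ i (mem_index_enum _))|k _]; last by rewrite indicE ler0n.
  by rewrite indicE gi0 mem_set// oner_eq0.
have e : sqrtmx (g x) *m mxfun (fun t => (Num.sqrt t)^-1) (g x) = 1%:M.
  rewrite /sqrtmx -mxfunM.
  transitivity (mxfun (fun=> 1) (g x)); last by rewrite mxfun_cst scale1r.
  by apply: eq_mxfun => i; rewrite mulfV// sqrtr_eq0 -ltNge.
exact: (mulmx1_unit e).1.
Qed.

Variables (J : set R) (alpha beta : R) (theta : R -> R).
Hypotheses (abJ : `[alpha, beta] `<=` J) (theta_convex : operator_convex J theta).

Lemma weighted_jensen_cone psi x : selfadjoint_in `[alpha, beta] (psi x) ->
  jensen_cone theta `[alpha, beta] (triple (povm_deriv nu x) (weighted nu psi x)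
    (weighted nu (fun x => mxfun theta (psi x)) x)).
Proof.
move=> spsi; rewrite -(sqrtmxK (povm_deriv_psd nu n_gt0 x)).
apply: jensen_cone_congr spsi; exact/hermmxP/sqrtmx_herm.
Qed.

Lemma conditional_jensen psi phi phi_theta :
  open J -> is_interval J -> alpha <= beta ->
  qmeasurable psi -> (forall x, selfadjoint_in `[alpha, beta] (psi x)) ->
  is_qcondexp nu FT psi phi ->
  is_qcondexp nu FT (fun x => mxfun theta (psi x)) phi_theta ->
  povm_ae nu [set x | selfadjoint_in J (phi x) /\
                      lownerle (mxfun theta (phi x)) (phi_theta x)].
Proof.
move=> openJ intJ ab /(qmeasurableP n_gt0) mpsi spsi cphi ctheta.
pose psit x := mxfun theta (psi x).
have [B HB] := operator_convex_bounded theta_convex abJ.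
have spec_in x i : alpha <= specval (psi x) i <= beta.
  have [hx sx] := spsi x.
  by have := spectrum_specval i hx sx; rewrite /= in_itv.
have mpsit : mxmeasurable psit.
  have -> : psit = fun x => mxfun (theta \_ `[alpha, beta]) (psi x).
    apply/funext => x; apply: eq_mxfun => i; rewrite patchE mem_set//.
    by rewrite /= in_itv; exact: spec_in.
  apply: mxfun_measurable => //; last by move=> x; case: (spsi x).
  exact: operator_convex_measurable theta_convex abJ.
have spsit x : selfadjoint_in `[- B, B] (psit x).
  have bnd i : - B <= theta (specval (psi x) i) <= B.
    by rewrite -ler_norml; exact: HB (spec_in x i).
  apply: psd_spectrum.
    have -> : psit x - (- B)%:C *: 1%:M = mxfun (fun t => theta t + B) (psi x).
      by rewrite (mxfunD theta (fun=> B)) mxfun_cst rmorphN scaleNr opprK.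
    by apply: psd_mxfun => i; have /andP[] := bnd i; lra.
  have -> : B%:C *: 1%:M - psit x = mxfun (fun t => B + -1 * theta t) (psi x).
    rewrite (mxfunD (fun=> B) (fun t => -1 * theta t)) (mxfunZ (-1) theta).
    by rewrite mxfun_cst rmorphN1 scaleN1r.
  by apply: psd_mxfun => i; have /andP[] := bnd i; lra.
have ipsi := bounded_weighted_integrable nu n_gt0 mpsi spsi.
have ipsit := bounded_weighted_integrable nu n_gt0 mpsit spsit.
have [_ _ ih hE] := povm_derivP nu n_gt0.
have [_ _ ig gE] := povm_derivP nuF n_gt0.
have [[_ qphi _] _] := cphi; have [[_ qphit _] _] := ctheta.
have iphi := qintegrable_weighted n_gt0 qphi.
have iphit := qintegrable_weighted n_gt0 qphit.
pose f x := triple (povm_deriv nu x) (weighted nu psi x) (weighted nu psit x).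
pose f' x := triple (g x) (weighted nuF phi x) (weighted nuF phi_theta x).
have if_ : forall i j, cintegrable mu setT (fun x => f x i j).
  exact: cintegrable_col ih (cintegrable_col ipsi ipsit).
have if' : forall i j, cintegrable muF setT (fun x => f' x i j).
  exact: cintegrable_col ig (cintegrable_col iphi iphit).
have eqf E : F E -> mxintegral muF E f' = mxintegral mu E f.
  move=> FE; rewrite /f /f' !mxintegral_col.
  rewrite (condexp_mxintegral ipsi cphi.1 FE) (condexp_mxintegral ipsit ctheta.1 FE).
  congr col_mx.
  transitivity (nu E); last exact: hE (FT FE).
  exact/esym/(gE _ (measurable_subE FE)).
have [A E dA /sub_measurableE FE|N1 [mN1 N10 N1P]] := @mx_ae_dual_nonneg _ _ _ muF _ _ f'
    (dual_cone (@jensen_cone _ theta n `[alpha, beta])) if'.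
  rewrite (eqf _ FE) (Re_tr_mxintegral _ (FT FE) if_).
  by apply: Rintegral_ge0 => x _; apply: dA; exact: weighted_jensen_cone.
have [N2 [mN2 N20 N2P]] := condexp_deriv_unit cphi.
have FN1 := sub_measurableE mN1.
exists (N1 `|` N2); split.
- by apply: measurableU => //; exact: FT.
- have muN2 : mu N2 = 0%E by rewrite /trace_measure N20 mxtrace0 mulr0.
  by apply: (trace_measure_eq0 n_gt0); rewrite (measureU0 (FT FN1) mN2 muN2); exact: N10.
- move=> x; apply: contra_notP => /not_orP [nN1 nN2] /=.
  have sa : (sqrtmx (g x))^t* = sqrtmx (g x) by exact/hermmxP/sqrtmx_herm.
  apply: (bidual_jensen theta_convex openJ intJ ab abJ sa (N2P _ nN2)) => A dA.
  rewrite (sqrtmxK (povm_deriv_psd nuF n_gt0 x)).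
  exact: N1P.
Qed.

End conditional_jensen.

Theorem mainTheorem7 (R : realType) (X : ptopologicalType) (n : nat)
  (hausdorffX : hausdorff_space X)
  (locally_compactX : locally_compact [set: X])
  (nu : povm (borelType X) R n)
  (F : set (set X)) (sigmaF : sigma_algebra setT F)
  (F_borel : F `<=` (measurable : set (set (borelType X))))
  (J : set R) (openJ : open J) (intervalJ : is_interval J)
  (alpha beta : R) (le_alpha_beta : alpha <= beta)
  (alpha_beta_J : `[alpha, beta] `<=` J)
  (psi : X -> 'M[R[i]]_n)
  (psi_qrv : @qmeasurable _ (borelType X) R n psi)
  (psi_sa : forall x, psi x \is hermsymmx)
  (psi_spec : forall x, spectrum_in `[alpha, beta] (psi x))
  (theta : R -> R) (theta_convex : operator_convex J theta)
  (phi phi_theta : X -> 'M[R[i]]_n)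
  (phi_condexp : is_qcondexp nu F_borel psi phi)
  (phi_theta_condexp :
     is_qcondexp nu F_borel (fun x => mxfun theta (psi x)) phi_theta) :
  povm_ae nu [set x | selfadjoint_in J (phi x) /\
                      lownerle (mxfun theta (phi x)) (phi_theta x)].
Proof.
have [n0|n_gt0] := posnP n.
  exists setT; split => //.
  by apply/matrixP => i; have := ltn_ord i; rewrite [X in (_ < X)%N]n0.
have spsi x : selfadjoint_in `[alpha, beta] (psi x) by split.
exact: (@conditional_jensen _ (borelType X) R n nu F F_borel n_gt0 sigmaF J
  alpha beta theta alpha_beta_J theta_convex psi phi phi_theta openJ intervalJ
  le_alpha_beta psi_qrv spsi phi_condexp phi_theta_condexp).
Qed.
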